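(* Let $X$ be an orbifold stratified $G$-space with stratification $\{pt\}=X_1\subseteq X_2\subseteq\cdots\subseteq X_\ell=X$ and associated simple orbifold $G$-bundles $\xi^{A_j}\colon V_j/A_j\to B_j$. If each equivariant Euler class $e_G(\xi^{A_j})\in E_G^\ast(B_j)$ is not a zero divisor, then the map $$\iota^\ast\colon E_G^\ast(X)\longrightarrow \prod_{j}E_G^\ast(B_j)$$ induced from the inclusion $\iota\colon\bigsqcup_j B_j\hookrightarrow X$ is injective.
   Context: $G$ is a topological group; a $G$-space means a finite $G$-CW complex. $E_G^\ast$ is a complex-oriented $G$-equivariant cohomology theory associated to a ring $G$-spectrum $E$, and $E_G^\ast(X)$ denotes $E_G^\ast(X)\otimes_{\mathbb{Z}}\mathbb{Q}$ throughout; the cohomology of a Thom space is reduced cohomology. Simple orbifold $G$-bundle: let $\xi\colon V\to B$ be a complex $E$-orientable $G$-vector bundle and $A$ a finite group acting linearly on each fiber of $\xi$, commuting with the $G$-action on $V$ and preserving the $E$-orientation of $\xi$. The induced bundle $\xi^A\colon V/A\to B$ is a simple orbifold $G$-bundle. Put $D(V/A)=D(V)/A$, $S(V/A)=S(V)/A$ (with $A$-invariant disc and sphere bundles), $\mathrm{Th}(V/A)=D(V/A)/S(V/A)$. Standing assumption on $E_G^\ast$: for every simple orbifold $G$-bundle of (real) rank $n$ over a space $B$ there is an equivariant Thom class $\eta_A\in E_G^{\ast}(\mathrm{Th}(V/A))$ such that cup product with $\eta_A$ is an isomorphism $E_G^\ast(B)\cong E_G^{\ast+n}(\mathrm{Th}(V/A))$.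 The equivariant Euler class $e_G(\xi^A)\in E_G^\ast(B)$ is the restriction of $\eta_A$ to the zero section. Orbifold stratified $G$-space: a $G$-space $X$ with a $G$-equivariant stratification $\{pt\}=X_1\subseteq X_2\subseteq\cdots\subseteq X_\ell=X$ such that each successive quotient $X_j/X_{j-1}$ is homeomorphic to the Thom space $\mathrm{Th}(V_j/A_j)$ of a simple orbifold $G$-bundle $\xi^{A_j}\colon V_j/A_j\to B_j$, and $X_j- X_{j-1}$ carries an effective orbifold structure. Thus $X_j$ is obtained from $X_{j-1}$ by attaching $D(V_j/A_j)$ along a $G$-equivariant map $\phi_j\colon S(V_j/A_j)\to X_{j-1}$ for $j=2,\dots,\ell$. Here $B_1=X_1$ is a point, and $B_j$ is included in $X$ as the zero section of $D(V_j/A_j)$. *)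

(* Defs.v *)
From HB Require Import structures.
From mathcomp Require Import all_boot all_order all_algebra fingroup.
From mathcomp Require Import monoid generic_quotient zify complex.
From mathcomp Require Import all_classical all_reals all_analysis.

Set Implicit Arguments.
Unset Strict Implicit.
Unset Printing Implicit Defensive.

Import Order.TTheory GRing.Theory Num.Theory.
Import numFieldNormedType.Exports.
Local Open Scope quotient_scope.
Local Open Scope classical_set_scope.
Local Open Scope ring_scope.

(* [A ⊗_Z Q] is presented as the localization of [A] at the nonzero integers:
   [frac a k] stands for [a ⊗ 1/(k+1)], and [frac a k = frac b l] iff
   [(l+1)a - (k+1)b] is a torsion element. *)
Section Rationalization.
Variable A : zmodType.

Definition frac_rel (x y : A * nat) : bool :=
  `[< exists m : nat, x.1 *+ (y.2.+1 * m.+1) = y.1 *+ (x.2.+1 * m.+1) >].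

Lemma frac_rel_refl : reflexive frac_rel.
Proof. by move=> x; apply/asboolP; exists 0%N. Qed.

Lemma frac_rel_sym : symmetric frac_rel.
Proof.
move=> x y; apply/asboolP/asboolP => -[m mE]; exists m; exact: esym.
Qed.

Lemma frac_rel_trans : transitive frac_rel.
Proof.
move=> [b l] [a k] [c n] /asboolP[m /= mE] /asboolP[p /= pE].
apply/asboolP; exists (l.+1 * (m.+1 * p.+1)).-1 => /=.
rewrite (_ : (n.+1 * _ = (l.+1 * m.+1) * (n.+1 * p.+1))%N); last by lia.
rewrite (_ : (k.+1 * _ = (l.+1 * p.+1) * (k.+1 * m.+1))%N); last by lia.
by rewrite [LHS]mulrnA mE [RHS]mulrnA -pE -!mulrnA mulnC.
Qed.

Canonical frac_equiv :=
  EquivRel frac_rel frac_rel_refl frac_rel_sym frac_rel_trans.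

Definition ratz := {eq_quot frac_equiv}.
HB.instance Definition _ := Choice.on ratz.
HB.instance Definition _ := Quotient.on ratz.

Definition frac (a : A) (k : nat) : ratz := \pi_ratz (a, k).
Definition rnum (x : ratz) : A := (repr x).1.
Definition rden (x : ratz) : nat := (repr x).2.

Lemma fracK x : frac (rnum x) (rden x) = x.
Proof. by rewrite /frac -surjective_pairing reprK. Qed.

Lemma frac_eq a k b l : frac a k = frac b l <->
  exists m : nat, a *+ (l.+1 * m.+1) = b *+ (k.+1 * m.+1).
Proof.
by split=> [/eqmodP/asboolP//|mE]; apply/eqmodP/asboolP.
Qed.

Lemma frac_repr a k : exists m : nat,
  rnum (frac a k) *+ (k.+1 * m.+1) = a *+ ((rden (frac a k)).+1 * m.+1).
Proof. by apply/frac_eq; rewrite fracK. Qed.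

Definition ratz_add (x y : ratz) : ratz :=
  frac (rnum x *+ (rden y).+1 + rnum y *+ (rden x).+1)
       ((rden x).+1 * (rden y).+1).-1.
Definition ratz_opp (x : ratz) : ratz := frac (- rnum x) (rden x).
Definition ratz_zero : ratz := frac 0 0.

Lemma ratz_addE a k b l : ratz_add (frac a k) (frac b l) =
  frac (a *+ l.+1 + b *+ k.+1) (k.+1 * l.+1).-1.
Proof.
apply/frac_eq.
have [m] := frac_repr a k; have [p] := frac_repr b l.
move: (rnum _) (rden _) (rnum _) (rden _) => a' k' b' l' bE aE.
exists (m.+1 * p.+1).-1; rewrite !(@prednK (_ * _)%N)// !mulrnDl -!mulrnA.
congr (_ + _).
  transitivity (a' *+ ((k.+1 * m.+1) * (l'.+1 * l.+1 * p.+1))).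
    by congr (_ *+ _); lia.
  by rewrite [LHS]mulrnA aE -mulrnA; congr (_ *+ _); lia.
transitivity (b' *+ ((l.+1 * p.+1) * (k'.+1 * k.+1 * m.+1))).
  by congr (_ *+ _); lia.
by rewrite [LHS]mulrnA bE -mulrnA; congr (_ *+ _); lia.
Qed.

Lemma ratz_oppE a k : ratz_opp (frac a k) = frac (- a) k.
Proof.
by apply/frac_eq; have [m mE] := frac_repr a k; exists m; rewrite !mulNrn mE.
Qed.

Lemma ratz_addA : associative ratz_add.
Proof.
move=> x y z; rewrite -(fracK x) -(fracK y) -(fracK z) !ratz_addE.
apply/frac_eq; exists 0%N.
by rewrite !(@prednK (_ * _)%N)// !mulrnDl -!mulrnA addrA;
  do 2?congr (_ + _); congr (_ *+ _); lia.
Qed.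

Lemma ratz_addC : commutative ratz_add.
Proof.
by move=> x y; rewrite -(fracK x) -(fracK y) !ratz_addE addrC mulnC.
Qed.

Lemma ratz_add0 : left_id ratz_zero ratz_add.
Proof.
move=> x; rewrite -(fracK x) ratz_addE mul0rn add0r mulr1n.
by congr frac; lia.
Qed.

Lemma ratz_addN : left_inverse ratz_zero ratz_opp ratz_add.
Proof.
move=> x; rewrite -(fracK x) ratz_oppE ratz_addE; apply/frac_eq.
by exists 0%N; rewrite mulNrn addNr !mul0rn.
Qed.

HB.instance Definition _ :=
  GRing.isZmodule.Build ratz ratz_addA ratz_addC ratz_add0 ratz_addN.

End Rationalization.

(* [f ⊗ Q] and the product [(a ⊗ q) (b ⊗ r) = f(a, b) ⊗ q r]; they are computed
   on representatives and well defined when [f] is (bi)additive. *)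
Definition ratz_map (A B : zmodType) (f : A -> B) (x : ratz A) : ratz B :=
  frac (f (rnum x)) (rden x).

Definition ratz_mul (A B C : zmodType) (f : A -> B -> C)
    (x : ratz A) (y : ratz B) : ratz C :=
  frac (f (rnum x) (rnum y)) ((rden x).+1 * (rden y).+1).-1.

Lemma ratz_mapE (A B : zmodType) (f : {additive A -> B}) a k :
  ratz_map f (frac a k) = frac (f a) k.
Proof.
apply/frac_eq; have [m mE] := frac_repr a k; exists m.
by rewrite -[LHS](raddfMn f) mE (raddfMn f).
Qed.

Lemma ratz_mulE (A B C : zmodType) (f : A -> B -> C) a k b l :
  (forall y, {morph f^~ y : x x' / x + x'}) ->
  (forall x, {morph f x : y y' / y + y'}) ->
  ratz_mul f (frac a k) (frac b l) = frac (f a b) (k.+1 * l.+1).-1.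
Proof.
move=> fDl fDr.
have f0l y : f 0 y = 0 by apply: (addIr (f 0 y)); rewrite -fDl !add0r.
have f0r x : f x 0 = 0 by apply: (addIr (f x 0)); rewrite -fDr !add0r.
have fMl n x y : f (x *+ n) y = f x y *+ n.
  by elim: n => [|n IH]; rewrite ?mulr0n// !mulrS fDl IH.
have fMr n x y : f x (y *+ n) = f x y *+ n.
  by elim: n => [|n IH]; rewrite ?mulr0n// !mulrS fDr IH.
apply/frac_eq.
have [m] := frac_repr a k; have [p] := frac_repr b l.
move: (rnum _) (rden _) (rnum _) (rden _) => a' k' b' l' bE aE.
exists (m.+1 * p.+1).-1; rewrite !(@prednK (_ * _)%N)//.
transitivity (f a' b' *+ (l.+1 * p.+1) *+ (k.+1 * m.+1)).
  by rewrite -mulrnA; congr (_ *+ _); lia.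
by rewrite -fMr -fMl aE bE fMr fMl -mulrnA; congr (_ *+ _); lia.
Qed.

HB.mixin Record isTopologicalGroup G of Group G & Topological G := {
  mulg_continuous : continuous (fun x : G * G => (x.1 * x.2)%g);
  invg_continuous : continuous (fun x : G => (x^-1)%g)
}.

#[short(type="topologicalGroupType")]
HB.structure Definition TopologicalGroup :=
  {G of Group G & Topological G & isTopologicalGroup G}.

Section GSpaces.
Variable G : topologicalGroupType.

Record gspace := GSpace {
  gcarrier :> topologicalType;
  gact : G -> gcarrier -> gcarrier;
  gact1 : forall x, gact 1%g x = x;
  gactM : forall g h x, gact (g * h)%g x = gact g (gact h x);
  gact_continuous : continuous (fun p : G * gcarrier => gact p.1 p.2)
}.

Record gmap (X Y : gspace) := GMap {
  gfun :> X -> Y;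
  gfun_continuous : continuous gfun;
  gfun_equivariant : forall g x, gfun (gact g x) = gact g (gfun x)
}.

Lemma gmap_id_cont (X : gspace) : continuous (@idfun X).
Proof. by move=> x. Qed.

Definition gmap_id (X : gspace) : gmap X X :=
  GMap (@gmap_id_cont X) (fun _ _ => erefl).

Lemma gmap_comp_cont (X Y Z : gspace) (g : gmap Y Z) (f : gmap X Y) :
  continuous (g \o f).
Proof. by move=> x; apply: continuous_comp; exact: gfun_continuous. Qed.

Lemma gmap_comp_equi (X Y Z : gspace) (g : gmap Y Z) (f : gmap X Y) a x :
  (g \o f) (gact a x) = gact a ((g \o f) x).
Proof. by rewrite /= !gfun_equivariant. Qed.

Definition gmap_comp (X Y Z : gspace) (g : gmap Y Z) (f : gmap X Y) :
  gmap X Z := GMap (@gmap_comp_cont _ _ _ g f) (gmap_comp_equi g f).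

Record gset (X : gspace) := GSet {
  gset_set :> set X;
  gset_inv : forall g x, gset_set x -> gset_set (gact g x)
}.

Lemma gset0_inv (X : gspace) (g : G) (x : X) : set0 x -> set0 (gact g x).
Proof. by []. Qed.
Definition gset0 (X : gspace) : gset X := GSet (@gset0_inv X).

Lemma gset_pre_inv (X Y : gspace) (f : gmap X Y) (S : gset Y) g x :
  (f @^-1` S) x -> (f @^-1` S) (gact g x).
Proof. by rewrite /preimage/= gfun_equivariant; exact: gset_inv. Qed.
Definition gset_pre (X Y : gspace) (f : gmap X Y) (S : gset Y) : gset X :=
  GSet (@gset_pre_inv _ _ f S).

Section Subspace.
Variables (X : gspace) (S : gset X).

Lemma gsub_in g (x : set_type S) : gact g (val x) \in (S : set X).
Proof. by apply/mem_set/gset_inv/set_mem/valP. Qed.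

Definition gsub_act (g : G) (x : set_type S) : set_type S :=
  exist _ (gact g (val x)) (gsub_in g x).

Lemma gsub_act1 x : gsub_act 1%g x = x.
Proof. by apply: val_inj; rewrite /= gact1. Qed.

Lemma gsub_actM g h x : gsub_act (g * h)%g x = gsub_act g (gsub_act h x).
Proof. by apply: val_inj; rewrite /= gactM. Qed.

Lemma gsub_val_cont : continuous (@set_val X S).
Proof. exact: initial_continuous. Qed.

Lemma gsub_act_cont : continuous (fun p : G * set_type S => gsub_act p.1 p.2).
Proof.
apply: continuous_comp_initial => p.
rewrite (_ : _ \o _ = (fun q : G * X => gact q.1 q.2) \o
  (fun q : G * set_type S => (q.1, set_val q.2))); last first.
  by apply/funext => -[].
apply: (@continuous_comp _ _ _ (fun q : G * set_type S => (q.1, set_val q.2)));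
  last exact: gact_continuous.
apply: cvg_pair; first exact: cvg_fst.
by apply: (@continuous_comp _ _ _ snd); [exact: cvg_snd|exact: gsub_val_cont].
Qed.

Definition gsub : gspace := GSpace gsub_act1 gsub_actM gsub_act_cont.

Definition gincl : gmap gsub X :=
  @GMap gsub X set_val gsub_val_cont (fun _ _ => erefl).

End Subspace.

Section Restriction.
Variables (X Y : gspace) (S : gset X) (T : gset Y) (f : gmap X Y).
Hypothesis fST : S `<=` f @^-1` T.

Lemma grestr_in (x : gsub S) : f (val x) \in (T : set Y).
Proof. by apply/mem_set/fST/set_mem/valP. Qed.

Definition grestr_fun (x : gsub S) : gsub T := exist _ (f (val x)) (grestr_in x).

Lemma grestr_cont : continuous grestr_fun.
Proof.
apply: continuous_comp_initial.
exact: (@gmap_comp_cont _ _ _ f (gincl S)).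
Qed.

Lemma grestr_equi g x : grestr_fun (gact g x) = gact g (grestr_fun x).
Proof. by apply: val_inj; rewrite /= gfun_equivariant. Qed.

Definition grestr : gmap (gsub S) (gsub T) := GMap grestr_cont grestr_equi.

End Restriction.

(* Quotient of a G-space by a G-invariant equivalence relation for which the
   quotient map is open; openness is what makes the action of G on the quotient
   continuous, without any local compactness assumption on G. *)
Section OpenQuotient.
Variables (X : gspace) (e : equiv_rel X).
Hypothesis e_act : forall g x y, e x y -> e (gact g x) (gact g y).
Hypothesis e_open : forall U : set X, open U ->
  open [set y | exists2 x, U x & e x y].

Definition gquot_type := quotient_topology {eq_quot e}.
HB.instance Definition _ := Topological.on gquot_type.
HB.instance Definition _ := Quotient.on gquot_type.

Definition gcls (x : X) : gquot_type := \pi_gquot_type x.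

Lemma gcls_eq x y : gcls x = gcls y <-> e x y.
Proof. by split=> [/eqmodP|exy]; last exact/eqmodP. Qed.

Lemma gcls_surj q : exists x, gcls x = q.
Proof. by exists (repr q); rewrite /gcls reprK. Qed.

Lemma gcls_cont : continuous gcls.
Proof. exact: pi_continuous. Qed.

Lemma gcls_open (U : set X) : open U -> open (gcls @` U).
Proof.
move=> oU; rewrite /open /= /quotient_open.
rewrite (_ : _ @^-1` _ = [set y | exists2 x, U x & e x y]); first exact: e_open.
apply/seteqP; split=> y /= [x Ux].
  by move=> /gcls_eq exy; exists x.
by move=> exy; exists x => //; apply/gcls_eq.
Qed.

Definition gquot_act (g : G) (q : gquot_type) : gquot_type :=
  gcls (gact g (repr q)).

Lemma gquot_actE g x : gquot_act g (gcls x) = gcls (gact g x).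
Proof. by apply/gcls_eq/e_act/gcls_eq; rewrite /gcls reprK. Qed.

Lemma gquot_act1 q : gquot_act 1%g q = q.
Proof. by have [x <-] := gcls_surj q; rewrite gquot_actE gact1. Qed.

Lemma gquot_actM g h q : gquot_act (g * h)%g q = gquot_act g (gquot_act h q).
Proof. by have [x <-] := gcls_surj q; rewrite !gquot_actE gactM. Qed.

Lemma gquot_act_cont :
  continuous (fun p : G * gquot_type => gquot_act p.1 p.2).
Proof.
move=> [g q] W /=; have [x <-] := gcls_surj q; rewrite gquot_actE => nW.
have := @gact_continuous X (g, x) _ (gcls_cont nW).
move=> [[/= P Q] [nP nQ] PQW].
exists (P, gcls @` Q) => /=.
  split=> //; move: nQ; rewrite nbhsE => -[U [oU Ux] UQ].
  apply: (@filterS _ _ _ (gcls @` U)); first exact: image_subset.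
  by apply: open_nbhs_nbhs; split; [exact: gcls_open|exists x].
move=> [h _] [/= Ph [y Qy <-]].
by rewrite gquot_actE; exact: (PQW (h, y)).
Qed.

Definition gquot : gspace := GSpace gquot_act1 gquot_actM gquot_act_cont.

Lemma gquot_lift_equi (Y : gspace) (f : gmap X Y) :
  (forall x y, e x y -> f x = f y) ->
  forall g (q : gquot), f (repr (gact g q)) = gact g (f (repr q)).
Proof.
move=> fe g q; have [x <-] := gcls_surj q.
have fr z : f (repr (gcls z)) = f z.
  by apply/fe/gcls_eq; rewrite /gcls reprK.
by rewrite /= gquot_actE !fr gfun_equivariant.
Qed.

Lemma gquot_lift_cont (Y : gspace) (f : gmap X Y) :
  (forall x y, e x y -> f x = f y) ->
  continuous (fun q : gquot => f (repr q)).
Proof.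
move=> fe; apply: repr_comp_continuous; first exact: gfun_continuous.
by move=> x y /eqP /gcls_eq /fe ->.
Qed.

Definition gquot_lift (Y : gspace) (f : gmap X Y)
    (fe : forall x y, e x y -> f x = f y) : gmap gquot Y :=
  GMap (gquot_lift_cont fe) (gquot_lift_equi fe).

Definition gproj : gmap X gquot :=
  @GMap X gquot gcls gcls_cont (fun g x => esym (gquot_actE g x)).

End OpenQuotient.

(* [X] is obtained from its subset [A] by simultaneously attaching the spaces
   [D i] along the maps [f i : S i -> A]: the maps [f i] send [S i], and only
   [S i], to [A], they identify the disjoint union of the [D i \ S i] with
   [X \ A], and [X] carries the pushout topology. *)
Definition attached (X : topologicalType) (A : set X) (I : Type)
    (D : I -> topologicalType) (S : forall i, set (D i))
    (f : forall i, D i -> X) : Prop :=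
  [/\ forall i, f i @^-1` A = S i,
      forall i x j y, ~ S i x -> f i x = f j y ->
        existT (fun i => D i) i x = existT (fun i => D i) j y,
      forall x, ~ A x -> exists i d, f i d = x
    & forall C : set X, closed C <->
        closed (set_val @^-1` C : set (set_type A)) /\
        (forall i, closed (f i @^-1` C))].

(* The pointed quotient [X / A], carried by the set [(X \ A) ⊔ {pt}] with the
   final topology for the collapse map; in particular [X / ∅ = X ⊔ {pt}]. *)
Section Collapse.
Variables (X : topologicalType) (A : set X).

Definition pquot := option (set_type (~` A)).
HB.instance Definition _ := Choice.on pquot.

Definition pcls (x : X) : pquot := insub x.

Definition pquot_open (U : set pquot) := open (pcls @^-1` U).

Lemma pquot_openT : pquot_open setT.
Proof. by rewrite /pquot_open preimage_setT; exact: openT. Qed.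
Lemma pquot_openI U V : pquot_open U -> pquot_open V -> pquot_open (U `&` V).
Proof. by rewrite /pquot_open preimage_setI; exact: openI. Qed.
Lemma pquot_open_bigU (I : Type) (f : I -> set pquot) :
  (forall i, pquot_open (f i)) -> pquot_open (\bigcup_i f i).
Proof.
by move=> fo; rewrite /pquot_open preimage_bigcup; apply: bigcup_open => i _;
  exact: fo.
Qed.
HB.instance Definition _ :=
  isOpenTopological.Build pquot pquot_openT pquot_openI pquot_open_bigU.

End Collapse.

Lemma gset_img_inv (X Y : gspace) (f : gmap X Y) (S : gset X) g y :
  (f @` S) y -> (f @` S) (gact g y).
Proof.
move=> [x Sx <-]; exists (gact g x); first exact: gset_inv.
exact: gfun_equivariant.
Qed.
Definition gset_img (X Y : gspace) (f : gmap X Y) (S : gset X) : gset Y :=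
  GSet (@gset_img_inv _ _ f S).

Record fin_action (A : finGroupType) (X : gspace) := FinAction {
  fact :> A -> gmap X X;
  fact1 : forall x, fact 1%g x = x;
  factM : forall a b x, fact (a * b)%g x = fact a (fact b x)
}.

Section FiniteQuotient.
Variables (A : finGroupType) (X : gspace) (act : fin_action A X).

Definition orb_rel (x y : X) : bool := [exists a, act a x == y].

Lemma orb_relP x y : reflect (exists a, act a x = y) (orb_rel x y).
Proof. by apply: (iffP existsP) => -[a /eqP]; exists a => //; apply/eqP. Qed.

Lemma orb_rel_refl : reflexive orb_rel.
Proof. by move=> x; apply/orb_relP; exists 1%g; rewrite fact1. Qed.

Lemma orb_rel_sym : symmetric orb_rel.
Proof.
suff s x y : orb_rel x y -> orb_rel y x by move=> x y; apply/idP/idP; exact: s.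
move=> /orb_relP[a <-]; apply/orb_relP; exists (a^-1)%g.
by rewrite -factM mulVg fact1.
Qed.

Lemma orb_rel_trans : transitive orb_rel.
Proof.
move=> y x z /orb_relP[a <-] /orb_relP[b <-]; apply/orb_relP.
by exists (b * a)%g; rewrite factM.
Qed.

Definition orb_equiv := EquivRel orb_rel orb_rel_refl orb_rel_sym orb_rel_trans.

Lemma orb_act g x y : orb_equiv x y -> orb_equiv (gact g x) (gact g y).
Proof.
move=> /orb_relP[a <-]; apply/orb_relP; exists a.
by rewrite gfun_equivariant.
Qed.

Lemma orb_open (U : set X) : open U ->
  open [set y | exists2 x, U x & orb_equiv x y].
Proof.
move=> oU.
rewrite (_ : [set _ | _] = \bigcup_(a : A) (act a @^-1` U)).
  apply: bigcup_open => a _; apply: open_comp => // x _.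
  exact: gfun_continuous.
apply/seteqP; split=> y /=.
  by move=> [x Ux /orb_relP[a axy]]; exists (a^-1)%g => //;
    rewrite /preimage /= -axy -factM mulVg fact1.
by move=> [a _ Uay]; exists (act a y) => //; rewrite orb_rel_sym;
  apply/orb_relP; exists a.
Qed.

Definition gorb : gspace := gquot orb_act orb_open.
Definition gorb_proj : gmap X gorb := gproj orb_act orb_open.

Lemma gorb_fun_inv (Y : gspace) (f : gmap X Y) :
  (forall a x, f (act a x) = f x) -> forall x y, orb_equiv x y -> f x = f y.
Proof. by move=> fA x y /orb_relP[a <-]; rewrite fA. Qed.

Definition gorb_lift (Y : gspace) (f : gmap X Y)
    (fA : forall a x, f (act a x) = f x) : gmap gorb Y :=
  gquot_lift orb_act orb_open (gorb_fun_inv fA).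

End FiniteQuotient.

Section ActionRestriction.
Variables (A : finGroupType) (X : gspace) (act : fin_action A X) (S : gset X).
Hypothesis actS : forall a, S `<=` act a @^-1` S.

Lemma fin_restr1 x : grestr (actS 1%g) x = x.
Proof. by apply: val_inj; rewrite /= fact1. Qed.

Lemma fin_restrM a b x :
  grestr (actS (a * b)%g) x = grestr (actS a) (grestr (actS b) x).
Proof. by apply: val_inj; rewrite /= factM. Qed.

Definition fin_restr : fin_action A (gsub S) :=
  FinAction fin_restr1 fin_restrM.

End ActionRestriction.

Record closed_subgroup := ClosedSubgroup {
  sg_set :> set G;
  sg_closed : closed sg_set;
  sg1 : sg_set 1%g;
  sgM : forall x y, sg_set x -> sg_set y -> sg_set (x * y)%g;
  sgV : forall x, sg_set x -> sg_set (x^-1)%g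
}.

Lemma gtrans_act1 (x : G) : (1 * x)%g = x. Proof. exact: mul1g. Qed.
Lemma gtrans_actM (g h x : G) : (g * h * x)%g = (g * (h * x))%g.
Proof. by rewrite mulgA. Qed.

Definition gtrans : gspace :=
  @GSpace G (fun g x => (g * x)%g) gtrans_act1 gtrans_actM (@mulg_continuous G).

Section Coset.
Variable H : closed_subgroup.

Definition coset_rel (x y : G) : bool := `[< sg_set H (x^-1 * y)%g >].

Lemma coset_rel_refl : reflexive coset_rel.
Proof. by move=> x; apply/asboolP; rewrite mulVg; exact: sg1. Qed.

Lemma coset_rel_sym : symmetric coset_rel.
Proof.
suff s x y : coset_rel x y -> coset_rel y x.
  by move=> x y; apply/idP/idP; exact: s.
by move=> /asboolP/sgV Hyx; apply/asboolP; rewrite invgM invgK in Hyx.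
Qed.

Lemma coset_rel_trans : transitive coset_rel.
Proof.
move=> y x z /asboolP Hxy /asboolP Hyz; apply/asboolP.
by have := sgM Hxy Hyz; rewrite mulgA -(mulgA x^-1%g) mulgV mulg1.
Qed.

Definition coset_equiv :=
  EquivRel coset_rel coset_rel_refl coset_rel_sym coset_rel_trans.

Lemma coset_act (g x y : gtrans) :
  coset_equiv x y -> coset_equiv (gact g x) (gact g y).
Proof.
move=> /asboolP Hxy; apply/asboolP => /=.
by rewrite invgM mulgA -(mulgA x^-1%g) mulVg mulg1.
Qed.

Lemma coset_open (U : set gtrans) : open U ->
  open [set y | exists2 x, U x & coset_equiv x y].
Proof.
move=> oU.
rewrite (_ : [set _ | _] =
    \bigcup_(h in [set h | sg_set H h]) ((fun x : G => x * h)%g @^-1` U)).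
  apply: bigcup_open => h _; apply: open_comp => // x _.
  apply: (@continuous_comp _ _ _ (fun y : G => (y, h))
    (fun p : G * G => (p.1 * p.2)%g)); last exact: mulg_continuous.
  by apply: cvg_pair; [exact: cvg_id|exact: cvg_cst].
apply/seteqP; split=> y /=.
  move=> [x Ux /asboolP Hxy]; exists (y^-1 * x)%g.
    by have := sgV Hxy; rewrite invgM invgK.
  by rewrite /preimage /= mulgA mulgV mul1g.
move=> [h Hh Uyh]; exists (y * h)%g => //; apply/asboolP.
by rewrite invgM -mulgA mulVg mulg1; exact: sgV.
Qed.

Definition gcoset : gspace := gquot coset_act coset_open.

End Coset.

Section ProductTrivial.
Variables (X : gspace) (T : topologicalType).

Definition gprod_act (g : G) (p : X * T) : X * T := (gact g p.1, p.2).

Lemma gprod_act1 p : gprod_act 1%g p = p.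
Proof. by case: p => x t; rewrite /gprod_act gact1. Qed.

Lemma gprod_actM g h p : gprod_act (g * h)%g p = gprod_act g (gprod_act h p).
Proof. by rewrite /gprod_act gactM. Qed.

Lemma gprod_act_cont :
  continuous (fun p : G * (X * T)%type => gprod_act p.1 p.2).
Proof.
move=> p; apply: cvg_pair.
  apply: (@continuous_comp _ _ _ (fun q : G * (X * T)%type => (q.1, q.2.1))
    (fun q : G * X => gact q.1 q.2)); last exact: gact_continuous.
  apply: cvg_pair; first exact: cvg_fst.
  by apply: (@continuous_comp _ _ _ snd fst); [exact: cvg_snd|exact: cvg_fst].
by apply: (@continuous_comp _ _ _ snd snd); [exact: cvg_snd|exact: cvg_snd].
Qed.

Definition gprod : gspace := GSpace gprod_act1 gprod_actM gprod_act_cont.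

End ProductTrivial.

End GSpaces.

Section Homotopy.
Variables (R : realType) (G : topologicalGroupType).

Definition disc (n : nat) : set 'rV[R]_n := [set v | \sum_i v 0 i ^+ 2 <= 1].
Arguments disc : clear implicits.

Definition gcell (H : closed_subgroup G) (n : nat) : gspace G :=
  gprod (gcoset H) (set_type (disc n)).
Definition gcell_bd (H : closed_subgroup G) (n : nat) : set (gcell H n) :=
  [set p : gcoset H * set_type (disc n) |
     \sum_i (set_val p.2) 0 i ^+ 2 = 1].

(* [cw_skel k] is the (k-1)-skeleton; [cw_skel k.+1] arises from it by attaching
   finitely many equivariant [k]-cells. *)
Record finite_gcw (X : gspace G) := FiniteGCW {
  cw_dim : nat;
  cw_skel : nat -> gset X;
  cw_cell : nat -> finType;
  cw_type : forall k, cw_cell k -> closed_subgroup G;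
  cw_char : forall k (i : cw_cell k),
    gmap (gcell (cw_type i) k) (gsub (cw_skel k.+1));
  cw_skel0 : cw_skel 0 = set0 :> set X;
  cw_skelT : cw_skel cw_dim.+1 = setT :> set X;
  cw_skelS : forall k, cw_skel k `<=` cw_skel k.+1;
  cw_attached : forall k,
    attached (set_val @^-1` cw_skel k : set (gsub (cw_skel k.+1)))
             (fun i : cw_cell k => @gcell_bd (cw_type i) k)
             (fun i : cw_cell k => cw_char i)
}.

Definition is_finite_gcw (X : gspace G) : Prop := inhabited (finite_gcw X).

(* G-homotopies are indexed by all of [R]; only their values on [0, 1] matter. *)
Definition is_ghomotopy (X Y : gspace G) (h : X -> R -> Y) : Prop :=
  {within [set p : X * R | 0 <= p.2 <= 1], continuous (fun p => h p.1 p.2)} /\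
  (forall g x t, 0 <= t <= 1 -> h (gact g x) t = gact g (h x t)).

Definition ghomotopic (X Y : gspace G) (f0 f1 : gmap X Y) : Prop :=
  exists h : X -> R -> Y,
    [/\ is_ghomotopy h, h^~ 0 =1 f0 & h^~ 1 =1 f1].

Record gpair := GPair { ptot : gspace G; psub : gset ptot }.

Record pmap (P Q : gpair) := PMap {
  pfun :> gmap (ptot P) (ptot Q);
  pfun_sub : psub P `<=` pfun @^-1` psub Q
}.

Definition pabs (X : gspace G) : gpair := GPair (gset0 X).

Lemma pmap_id_sub (P : gpair) : psub P `<=` gmap_id (ptot P) @^-1` psub P.
Proof. by []. Qed.
Definition pmap_id (P : gpair) : pmap P P := PMap (@pmap_id_sub P).

Lemma pmap_comp_sub (P Q T : gpair) (g : pmap Q T) (f : pmap P Q) :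
  psub P `<=` gmap_comp g f @^-1` psub T.
Proof. by move=> x Px; exact/(@pfun_sub _ _ g)/(@pfun_sub _ _ f). Qed.
Definition pmap_comp (P Q T : gpair) (g : pmap Q T) (f : pmap P Q) : pmap P T :=
  PMap (@pmap_comp_sub P Q T g f).

Lemma pmap_abs_sub (X Y : gspace G) (f : gmap X Y) :
  psub (pabs X) `<=` f @^-1` psub (pabs Y).
Proof. by []. Qed.
Definition pmap_abs (X Y : gspace G) (f : gmap X Y) : pmap (pabs X) (pabs Y) :=
  PMap (@pmap_abs_sub X Y f).

Lemma pmap_rel_sub (P : gpair) :
  psub (pabs (ptot P)) `<=` gmap_id (ptot P) @^-1` psub P.
Proof. by []. Qed.
Definition pmap_rel (P : gpair) : pmap (pabs (ptot P)) P :=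
  PMap (@pmap_rel_sub P).

Definition pmap_incl (P : gpair) : pmap (pabs (gsub (psub P))) (pabs (ptot P)) :=
  pmap_abs (gincl (psub P)).

Definition pmap_restr (P Q : gpair) (f : pmap P Q) :
    pmap (pabs (gsub (psub P))) (pabs (gsub (psub Q))) :=
  pmap_abs (grestr (@pfun_sub P Q f)).

Definition pair_ghomotopic (P Q : gpair) (f0 f1 : pmap P Q) : Prop :=
  exists h : ptot P -> R -> ptot Q,
    [/\ is_ghomotopy h, h^~ 0 =1 f0, h^~ 1 =1 f1
      & forall x t, gset_set (psub P) x -> 0 <= t <= 1 ->
          gset_set (psub Q) (h x t)].

(* [A ⊆ X] is closed and has the G-homotopy extension property. *)
Definition gcofibration (P : gpair) : Prop :=
  closed (psub P : set (ptot P)) /\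
  forall (Y : gspace G) (f : gmap (ptot P) Y) (h : gsub (psub P) -> R -> Y),
    is_ghomotopy h -> h^~ 0 =1 f \o set_val ->
    exists k : ptot P -> R -> Y,
      [/\ is_ghomotopy k, k^~ 0 =1 f
        & forall a t, 0 <= t <= 1 -> k (set_val a) t = h a t].

End Homotopy.

Section Cohomology.
Variables (R : realType) (G : topologicalGroupType).

(* [coh_cup] is the action of [E^*(X)] on [E^*(X, A)]; for [A = ∅] it is the
   product of the ring [E^*(X)], whose unit is [coh_one]. *)
Record cohData := CohData {
  coh : int -> gpair G -> zmodType;
  coh_pull : forall n P Q, pmap P Q -> coh n Q -> coh n P;
  coh_delta : forall n P, coh n (pabs (gsub (psub P))) -> coh (n + 1) P;
  coh_one : forall X, coh 0 (pabs X);
  coh_cup : forall p q P, coh p (pabs (ptot P)) -> coh q P -> coh (p + q) P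
}.

Definition coh_cast (E : cohData) (m n : int) (P : gpair G) (e : m = n)
  (x : coh E m P) : coh E n P := ecast k (coh E k P) e x.

Definition koszul (k : int) : int := (-1) ^+ `|k|%N.

(* The excision axiom says that, if [X] is obtained from [A] by attaching [D]
   along a G-cofibration [S ⊆ D], then [E^*(X, A) = E^*(D, S)]; for [A] a point it
   identifies the reduced cohomology of [D / S] with [E^*(D, S)]. *)
Record cohAxioms (E : cohData) : Prop := CohAxioms {
  coh_pullD : forall n P Q (f : pmap P Q),
    {morph @coh_pull E n P Q f : x y / x + y};
  coh_pull_id : forall n P (x : coh E n P), coh_pull (pmap_id P) x = x;
  coh_pull_comp : forall n P Q T (g : pmap Q T) (f : pmap P Q) (x : coh E n T),
    coh_pull (pmap_comp g f) x = coh_pull f (coh_pull g x);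
  coh_homotopy : forall n P Q (f g : pmap P Q), pair_ghomotopic R f g ->
    @coh_pull E n P Q f =1 coh_pull g;
  coh_deltaD : forall n P, {morph @coh_delta E n P : x y / x + y};
  coh_delta_nat : forall n P Q (f : pmap P Q)
      (x : coh E n (pabs (gsub (psub Q)))),
    coh_pull f (coh_delta x) = coh_delta (coh_pull (pmap_restr f) x);
  coh_exact_tot : forall n P (x : coh E n (pabs (ptot P))),
    coh_pull (pmap_incl P) x = 0 <-> exists y, coh_pull (pmap_rel P) y = x;
  coh_exact_sub : forall n P (x : coh E n (pabs (gsub (psub P)))),
    coh_delta x = 0 <-> exists y, coh_pull (pmap_incl P) y = x;
  coh_exact_rel : forall n P (x : coh E (n + 1) P),
    coh_pull (pmap_rel P) x = 0 <-> exists y, coh_delta y = x;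
  coh_excision : forall n P Q (f : pmap P Q), gcofibration R P ->
    attached (psub Q : set (ptot Q)) (fun _ : unit => psub P : set (ptot P))
             (fun _ : unit => f) ->
    bijective (@coh_pull E n P Q f);
  coh_cupDl : forall p q P (y : coh E q P),
    {morph (@coh_cup E p q P)^~ y : x x' / x + x'};
  coh_cupDr : forall p q P (x : coh E p (pabs (ptot P))),
    {morph @coh_cup E p q P x : y y' / y + y'};
  coh_cup_nat : forall p q P Q (f : pmap P Q)
      (x : coh E p (pabs (ptot Q))) (y : coh E q Q),
    coh_pull f (coh_cup x y) = coh_cup (coh_pull (pmap_abs f) x) (coh_pull f y);
  coh_one_nat : forall X Y (f : gmap X Y),
    coh_pull (pmap_abs f) (coh_one E Y) = coh_one E X;
  coh_cup1l : forall q P (y : coh E q P),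
    coh_cast (add0r q) (coh_cup (coh_one E (ptot P)) y) = y;
  coh_cupA : forall p q r P (x : coh E p (pabs (ptot P)))
      (y : coh E q (pabs (ptot P))) (z : coh E r P),
    coh_cast (addrA p q r) (coh_cup x (coh_cup y z)) =
    coh_cup (coh_cup (P := pabs (ptot P)) x y) z;
  coh_cupC : forall p q X (x : coh E p (pabs X)) (y : coh E q (pabs X)),
    coh_cup (P := pabs X) x y =
    coh_cast (addrC q p) (coh_cup (P := pabs X) y x *~ koszul (p * q));
  coh_cup_delta : forall p q P (x : coh E p (pabs (ptot P)))
      (a : coh E q (pabs (gsub (psub P)))),
    coh_cup x (coh_delta a) =
    coh_cast (esym (addrA p q 1))
      (coh_delta (coh_cup (P := pabs (gsub (psub P)))
                          (coh_pull (pmap_incl P) x) a) *~ koszul p)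
}.

(* [E] is the theory of a G-spectrum: [E^n] is represented on finite G-CW
   complexes by a G-space, the [n]-th space of the spectrum. By the Yoneda lemma
   the structure maps and the multiplication of the spectrum are the operations
   representing the connecting maps and the products of [E]. *)
Definition coh_represented (E : cohData) : Prop :=
  forall n : int, exists (Z : gspace G) (u : coh E n (pabs Z)),
  forall X : gspace G, is_finite_gcw R X ->
    (forall x : coh E n (pabs X),
       exists f : gmap X Z, coh_pull (pmap_abs f) u = x) /\
    (forall f g : gmap X Z,
       coh_pull (pmap_abs f) u = coh_pull (pmap_abs g) u <-> ghomotopic R f g).

Definition coh_rat (E : cohData) : cohData := {|
  coh := fun n P => ratz (coh E n P);
  coh_pull := fun n P Q f => ratz_map (@coh_pull E n P Q f);
  coh_delta := fun n P => ratz_map (@coh_delta E n P);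
  coh_one := fun X => frac (coh_one E X) 0;
  coh_cup := fun p q P => ratz_mul (@coh_cup E p q P)
|}.

(* As [x] is homogeneous, it suffices to test it against homogeneous [y]. *)
Definition zero_divisor (E : cohData) (X : gspace G) (p : int)
    (x : coh E p (pabs X)) : Prop :=
  exists (q : int) (y : coh E q (pabs X)),
    y <> 0 /\ (coh_cup (P := pabs X) x y = 0 \/ coh_cup (P := pabs X) y x = 0).

(* [u] is a Thom class of degree [n] for a pair [(D, S)] over [B]: the cup product
   with [u] is an isomorphism from [E^m(B)] onto [E^(m+n)(D, S)], the reduced
   cohomology of [D / S], for all [m]. *)
Definition thom_class (E : cohData) (P : gpair G) (B : gspace G)
    (p : gmap (ptot P) B) (n : int) (u : coh E n P) : Prop :=
  forall m : int, bijective
    (fun b : coh E m (pabs B) => coh_cup (coh_pull (pmap_abs p) b) u).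

End Cohomology.

Section Bundles.
Variables (R : realType) (G : topologicalGroupType).

Definition cplx : numFieldType := R[i].

Section Bundle.
Variable B : gspace G.

(* The operations [vadd] and [vherm] are meaningful on pairs of vectors of the
   same fiber; local triviality makes each fiber a complex vector space. The
   G-invariant Hermitian metric serves to define disc and sphere bundles. *)
Record cbundle := CBundle {
  vtot : gspace G;
  vrank : nat;
  vproj : gmap vtot B;
  vzero : gmap B vtot;
  vadd : vtot -> vtot -> vtot;
  vscale : cplx -> vtot -> vtot;
  vherm : vtot -> vtot -> cplx;
  vproj_zero : forall b, vproj (vzero b) = b;
  vproj_add : forall v w, vproj v = vproj w -> vproj (vadd v w) = vproj v;
  vproj_scale : forall c v, vproj (vscale c v) = vproj v;
  vscale0 : forall v, vscale 0 v = vzero (vproj v);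
  vlocal : forall b0 : B,
    exists (U : set B) (h : B * 'rV[cplx]_vrank -> vtot)
           (k : vtot -> 'rV[cplx]_vrank),
    [/\ open U, U b0, {within U `*` setT, continuous h},
        {within vproj @^-1` U, continuous k}
      & [/\ forall b x, U b -> vproj (h (b, x)) = b,
            forall b x, U b -> k (h (b, x)) = x,
            forall v, U (vproj v) -> h (vproj v, k v) = v,
            forall b x y, U b -> h (b, x + y) = vadd (h (b, x)) (h (b, y))
          & forall b c x, U b -> h (b, c *: x) = vscale c (h (b, x))]];
  vadd_act : forall g v w, vproj v = vproj w ->
    gact g (vadd v w) = vadd (gact g v) (gact g w);
  vscale_act : forall g c v, gact g (vscale c v) = vscale c (gact g v);
  vherm_continuous : {within [set p : vtot * vtot | vproj p.1 = vproj p.2],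
    continuous (fun p => vherm p.1 p.2)};
  vhermDl : forall u v w, vproj u = vproj w -> vproj v = vproj w ->
    vherm (vadd u v) w = vherm u w + vherm v w;
  vhermZl : forall c v w, vproj v = vproj w ->
    vherm (vscale c v) w = c * vherm v w;
  vhermC : forall v w, vproj v = vproj w -> vherm w v = conjc (vherm v w);
  vherm_ge0 : forall v, 0 <= vherm v v;
  vherm_eq0 : forall v, vherm v v = 0 -> v = vzero (vproj v);
  vherm_act : forall g v w, vproj v = vproj w ->
    vherm (gact g v) (gact g w) = vherm v w
}.

Variable V : cbundle.

Definition vnormsq (v : vtot V) : R := complex.Re (vherm v v).

Lemma vnormsq_act g v : vnormsq (gact g v) = vnormsq v.
Proof. by rewrite /vnormsq vherm_act. Qed.

Lemma vnormsq_zero b : vnormsq (vzero V b) = 0.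
Proof.
rewrite /vnormsq -[X in vherm X _](_ : vscale 0 (vzero V b) = _).
  by rewrite vhermZl// mul0r.
by rewrite vscale0 vproj_zero.
Qed.

Lemma vdisc_inv g (v : vtot V) :
  [set v | vnormsq v <= 1] v -> [set v | vnormsq v <= 1] (gact g v).
Proof. by rewrite /= vnormsq_act. Qed.
Definition vdisc : gset (vtot V) := GSet vdisc_inv.

Lemma vsphere_inv g (v : vtot V) :
  [set v | vnormsq v = 1] v -> [set v | vnormsq v = 1] (gact g v).
Proof. by rewrite /= vnormsq_act. Qed.
Definition vsphere : gset (vtot V) := GSet vsphere_inv.

Definition vpair : gpair G := GPair (gset_pre (gincl vdisc) vsphere).

Definition vpair_proj : gmap (ptot vpair) B := gmap_comp (vproj V) (gincl vdisc).

End Bundle.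

(* A bundle map over [f0] which is an isometric isomorphism on each fiber. *)
Record bundle_map (B B' : gspace G) (V : cbundle B) (V' : cbundle B') :=
    BundleMap {
  bm_base : gmap B B';
  bm_tot : gmap (vtot V) (vtot V');
  bm_rank : vrank V' = vrank V;
  bm_proj : forall v, vproj V' (bm_tot v) = bm_base (vproj V v);
  bm_add : forall v w, vproj V v = vproj V w ->
    bm_tot (vadd v w) = vadd (bm_tot v) (bm_tot w);
  bm_scale : forall c v, bm_tot (vscale c v) = vscale c (bm_tot v);
  bm_herm : forall v w, vproj V v = vproj V w ->
    vherm (bm_tot v) (bm_tot w) = vherm v w
}.

Section BundleMap.
Variables (B B' : gspace G) (V : cbundle B) (V' : cbundle B').
Variable f : bundle_map V V'.

Lemma bm_normsq v : vnormsq (bm_tot f v) = vnormsq v.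
Proof. by rewrite /vnormsq bm_herm. Qed.

Lemma bm_disc : vdisc V `<=` bm_tot f @^-1` vdisc V'.
Proof. by move=> v; rewrite /preimage /= bm_normsq. Qed.

Lemma bm_sphere :
  psub (vpair V) `<=` grestr bm_disc @^-1` psub (vpair V').
Proof. by move=> v; exact: etrans (bm_normsq _). Qed.

Definition bm_pair : pmap (vpair V) (vpair V') := PMap bm_sphere.

End BundleMap.

Definition real_rank (B : gspace G) (V : cbundle B) : int := (vrank V).*2%:Z.

Lemma bm_real_rank (B B' : gspace G) (V : cbundle B) (V' : cbundle B') :
  bundle_map V V' -> real_rank V' = real_rank V.
Proof. by move=> /bm_rank; rewrite /real_rank => ->. Qed.

(* A complex orientation: a choice of Thom classes for all complex G-vector
   bundles over finite G-CW complexes, natural in the bundle. *)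
Definition complex_oriented (E : cohData G) : Prop :=
  exists th : forall (B : gspace G) (V : cbundle B),
      coh E (real_rank V) (vpair V),
    (forall B V, is_finite_gcw R B -> thom_class (vpair_proj V) (th B V)) /\
    (forall B B' (V : cbundle B) (V' : cbundle B') (f : bundle_map V V'),
      is_finite_gcw R B -> is_finite_gcw R B' ->
      coh_cast (bm_real_rank f) (coh_pull (bm_pair f) (th B' V')) = th B V).

(* An action of [A] on [V] by G-maps (hence commuting with [G]) which is linear
   on each fiber and preserves the disc and sphere bundles. *)
Record bundle_action (A : finGroupType) (B : gspace G) (V : cbundle B) :=
    BundleAction {
  ba_act :> fin_action A (vtot V);
  ba_proj : forall a v, vproj V (ba_act a v) = vproj V v;
  ba_add : forall a v w, vproj V v = vproj V w ->
    ba_act a (vadd v w) = vadd (ba_act a v) (ba_act a w);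
  ba_scale : forall a c v, ba_act a (vscale c v) = vscale c (ba_act a v);
  ba_normsq : forall a v, vnormsq (ba_act a v) = vnormsq v
}.

Section BundleAction.
Variables (A : finGroupType) (B : gspace G) (V : cbundle B).
Variable act : bundle_action A V.

Lemma ba_disc a : vdisc V `<=` act a @^-1` vdisc V.
Proof. by move=> v; rewrite /preimage /= ba_normsq. Qed.

Lemma ba_sphere a : psub (vpair V) `<=` grestr (ba_disc a) @^-1` psub (vpair V).
Proof. by move=> v; exact: etrans (ba_normsq _ _ _). Qed.

Definition ba_pair (a : A) : pmap (vpair V) (vpair V) := PMap (@ba_sphere a).

Definition ba_disc_act : fin_action A (gsub (vdisc V)) := fin_restr ba_disc.

Definition orb_pair : gpair G :=
  GPair (gset_img (gorb_proj ba_disc_act) (psub (vpair V))).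

Lemma orb_pair_projE a v :
  vpair_proj V (ba_disc_act a v) = vpair_proj V v.
Proof. exact: ba_proj. Qed.

Definition orb_pair_proj : gmap (ptot orb_pair) B := gorb_lift orb_pair_projE.

Lemma vzero_disc b : vzero V b \in (vdisc V : set (vtot V)).
Proof. by apply/mem_set; rewrite /= vnormsq_zero ler01. Qed.

Definition disc_zero_fun (b : B) : gsub (vdisc V) :=
  exist _ (vzero V b) (vzero_disc b).

Lemma disc_zero_cont : continuous disc_zero_fun.
Proof.
by apply: continuous_comp_initial => b; exact: (@gfun_continuous _ _ _ (vzero V)).
Qed.

Lemma disc_zero_equi g b : disc_zero_fun (gact g b) = gact g (disc_zero_fun b).
Proof. by apply: val_inj; rewrite /= gfun_equivariant. Qed.

Definition disc_zero : gmap B (gsub (vdisc V)) :=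
  GMap disc_zero_cont disc_zero_equi.

Definition orb_pair_zero : gmap B (ptot orb_pair) :=
  gmap_comp (gorb_proj ba_disc_act) disc_zero.

End BundleAction.

Record simple_orbibundle (E : cohData G) (B : gspace G) := SimpleOrbibundle {
  so_bundle : cbundle B;
  so_group : finGroupType;
  so_act : bundle_action so_group so_bundle;
  so_orient : coh E (real_rank so_bundle) (vpair so_bundle);
  so_orientP : thom_class (vpair_proj so_bundle) so_orient;
  so_orient_inv : forall a, coh_pull (ba_pair so_act a) so_orient = so_orient
}.

Section OrbibundleTheory.
Variables (E : cohData G) (B : gspace G) (xi : simple_orbibundle E B).

Definition so_rank : int := real_rank (so_bundle xi).
Definition so_pair : gpair G := orb_pair (so_act xi).
Definition so_proj : gmap (ptot so_pair) B := orb_pair_proj (so_act xi).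
Definition so_zero : gmap B (ptot so_pair) := orb_pair_zero (so_act xi).

(* The reduced cohomology of [Th(V/A)] is taken to be [E^*(D(V)/A, S(V)/A)]: the
   quotient [D(V)/A / S(V)/A], formed in topological spaces, carries a continuous
   action of [G] only under a local compactness assumption. *)
Definition euler_class (eta : coh E so_rank so_pair) : coh E so_rank (pabs B) :=
  coh_pull (pmap_abs so_zero) (coh_pull (pmap_rel so_pair) eta).

End OrbibundleTheory.

Definition orbi_thom_classes (E : cohData G)
    (eta : forall B (xi : simple_orbibundle E B), coh E (so_rank xi) (so_pair xi))
    : Prop :=
  forall B (xi : simple_orbibundle E B), is_finite_gcw R B ->
    thom_class (so_proj xi) (eta B xi).

End Bundles.

Section Orbifold.
Variable R : realType.

Fixpoint Ck (k m n : nat) (U : set 'rV[R]_m) (f : 'rV[R]_m -> 'rV[R]_n)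
    {struct k} : Prop :=
  (forall x, U x -> {for x, continuous f}) /\
  if k is k'.+1 then
    forall v : 'rV[R]_m,
      (forall x i, U x -> derivable (fun t : R => f (x + t *: v) 0 i) 0 1) /\
      Ck k' U (fun x => \row_i 'D_1 (fun t : R => f (x + t *: v) 0 i) 0)
  else True.

Definition smooth_on (m n : nat) (U : set 'rV[R]_m) (f : 'rV[R]_m -> 'rV[R]_n) :
  Prop := forall k, Ck k U f.

(* The last three fields say that [oc_map] induces a homeomorphism from
   [oc_dom / oc_group] onto an open subset of [Y]. *)
Record orb_chart (Y : topologicalType) := OrbChart {
  oc_dim : nat;
  oc_dom : set 'rV[R]_oc_dim;
  oc_group : finGroupType;
  oc_act : oc_group -> 'rV[R]_oc_dim -> 'rV[R]_oc_dim;
  oc_map : 'rV[R]_oc_dim -> Y;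
  oc_dom_open : open oc_dom;
  oc_dom_connected : connected oc_dom;
  oc_act_dom : forall a x, oc_dom x -> oc_dom (oc_act a x);
  oc_act1 : forall x, oc_dom x -> oc_act 1%g x = x;
  oc_actM : forall a b x, oc_dom x ->
    oc_act (a * b)%g x = oc_act a (oc_act b x);
  oc_act_smooth : forall a, smooth_on oc_dom (oc_act a);
  oc_act_effective : forall a,
    (forall x, oc_dom x -> oc_act a x = x) -> a = 1%g;
  oc_map_continuous : forall x, oc_dom x -> {for x, continuous oc_map};
  oc_map_orbit : forall x y, oc_dom x -> oc_dom y ->
    (oc_map x = oc_map y <-> exists a, oc_act a x = y);
  oc_map_open : forall W, open W -> W `<=` oc_dom -> open (oc_map @` W)
}.

Arguments oc_dom {Y} _.
Arguments oc_map {Y} _ _.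

Definition oc_image (Y : topologicalType) (c : orb_chart Y) : set Y :=
  oc_map c @` oc_dom c.

(* A smooth open embedding of [U] into [V]; it forces [m = n] unless [U = ∅]. *)
Definition smooth_embedding (m n : nat) (U : set 'rV[R]_m) (V : set 'rV[R]_n)
    (f : 'rV[R]_m -> 'rV[R]_n) : Prop :=
  [/\ smooth_on U f, f @` U `<=` V, open (f @` U)
    & exists2 g : 'rV[R]_n -> 'rV[R]_m,
        smooth_on (f @` U) g & forall x, U x -> g (f x) = x].

Definition chart_embeds (Y : topologicalType) (c c' : orb_chart Y) : Prop :=
  exists2 f, smooth_embedding (oc_dom c) (oc_dom c') f
    & forall x, oc_dom c x -> oc_map c' (f x) = oc_map c x.

Definition paracompact (Y : topologicalType) : Prop :=
  forall (I : Type) (U : I -> set Y),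
    (forall i, open (U i)) -> \bigcup_i U i = setT ->
    exists (J : Type) (V : J -> set Y),
      [/\ forall j, open (V j), \bigcup_j V j = setT,
          forall j, exists i, V j `<=` U i
        & forall y : Y, exists2 N, nbhs y N
            & finite_set [set j | V j `&` N !=set0]].

(* The dimension of an effective orbifold may vary between components. *)
Definition effective_orbifold (Y : topologicalType) : Prop :=
  [/\ hausdorff_space Y, paracompact Y
    & exists (I : Type) (c : I -> orb_chart Y),
        \bigcup_i oc_image (c i) = setT /\
        forall i j y, oc_image (c i) y -> oc_image (c j) y ->
          exists c0 : orb_chart Y,
            [/\ oc_image c0 y, chart_embeds c0 (c i) & chart_embeds c0 (c j)]].

End Orbifold.

Section Stratified.
Variables (R : realType) (G : topologicalGroupType).
Variable E : cohData G.

Definition homeomorphism (X Y : topologicalType) (h : X -> Y) : Prop :=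
  continuous h /\ exists k, [/\ continuous k, cancel h k & cancel k h].

(* [os_strat j] is the stratum with index [j + 1] of the filtration
   [{pt} = X_1 ⊆ ... ⊆ X_(os_len + 1) = X], and [os_bundle j] is the bundle whose
   disc bundle [D(V/A)] is attached to [os_strat j], through the characteristic
   map [os_char j], to obtain [os_strat j.+1]. *)
Record orbi_stratified (X : gspace G) := OrbiStratified {
  os_len : nat;
  os_strat : nat -> gset X;
  os_pt : exists x : X, os_strat 0 = [set x] :> set X;
  os_top : os_strat os_len = setT :> set X;
  os_mono : forall j, os_strat j `<=` os_strat j.+1;
  os_base : 'I_os_len -> gspace G;
  os_base_gcw : forall j, is_finite_gcw R (os_base j);
  os_bundle : forall j, simple_orbibundle R E (os_base j);
  os_char : forall j : 'I_os_len,
    gmap (ptot (so_pair (os_bundle j))) (gsub (os_strat j.+1));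
  os_attached : forall j : 'I_os_len,
    attached (set_val @^-1` os_strat j : set (gsub (os_strat j.+1)))
      (fun _ : unit => psub (so_pair (os_bundle j)) : set (ptot _))
      (fun _ : unit => os_char j);
  os_thom : forall j : 'I_os_len,
    exists2 h : pquot (set_val @^-1` os_strat j : set (gsub (os_strat j.+1))) ->
                pquot (psub (so_pair (os_bundle j)) : set (ptot _)),
      homeomorphism h & forall d, h (pcls _ (os_char j d)) = pcls _ d;
  os_orbifold : forall j : 'I_os_len,
    effective_orbifold R
      (set_type (os_strat j.+1 `\` os_strat j) : topologicalType)
}.

Variables (X : gspace G) (S : orbi_stratified X).

Definition os_incl (j : 'I_(os_len S)) : gmap (os_base j) X :=
  gmap_comp (gincl (os_strat S j.+1))
    (gmap_comp (os_char j) (so_zero (os_bundle j))).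

(* The first component is the restriction to the point [B_1 = X_1]. *)
Definition os_restrict (n : int) (x : coh E n (pabs X)) :
    coh E n (pabs (gsub (os_strat S 0))) *
    (forall j : 'I_(os_len S), coh E n (pabs (os_base j))) :=
  (coh_pull (pmap_abs (gincl (os_strat S 0))) x,
   fun j => coh_pull (pmap_abs (os_incl j)) x).

End Stratified.

(* Main.v *)
(** Restriction to [X_j] and to [B_(j+1)] is jointly injective on [E^*(X_(j+1))]:
    a class that vanishes on [X_j] lifts to [E^*(X_(j+1), X_j)], which excision
    and the Thom isomorphism identify with [E^*(B_(j+1))] up to a shift; on the
    zero section the lift restricts to multiplication by the Euler class, which is
    injective. Induction along the stratification then gives the theorem.

    Excision needs [S(V)/A ⊆ D(V)/A] to be a G-cofibration. Radial projection
    commutes with [G] and [A], and it retracts the cylinder on the disc bundle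
    onto its bottom together with the cylinder on the sphere bundle. *)
Require Import Defs.
From HB Require Import structures.
From mathcomp Require Import all_boot all_order all_algebra.
From mathcomp Require Import all_classical all_reals all_analysis.
From mathcomp Require Import fingroup generic_quotient complex lra.
Import Defs.

Set Implicit Arguments.
Unset Strict Implicit.
Unset Printing Implicit Defensive.

Import Order.TTheory GRing.Theory Num.Theory.
Import numFieldNormedType.Exports.
Local Open Scope classical_set_scope.
Local Open Scope ring_scope.

(** * Pullbacks, products and exactness after tensoring with [Q] *)

Section RationalCohomology.
Variables (R : realType) (G : topologicalGroupType) (E : cohData G).
Hypothesis hE : cohAxioms R E.

Fact coh_pull_zmod_morphism n (P Q : gpair G) (f : pmap P Q) :
  zmod_morphism (@coh_pull G E n P Q f).
Proof.
have D := coh_pullD hE f; move=> x y.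
by apply: (addIr (coh_pull f y)); rewrite -D !subrK.
Qed.

Let pull n P Q f : {additive coh E n Q -> coh E n P} :=
  HB.pack (@coh_pull G E n P Q f)
    (GRing.isZmodMorphism.Build _ _ _ (coh_pull_zmod_morphism f)).

Arguments pull {n P Q} f.

Lemma frac_eq0 (A : zmodType) (a : A) k :
  frac a k = 0 <-> exists m : nat, a *+ m.+1 = 0.
Proof.
by rewrite frac_eq; split=> -[m mE]; exists m; move: mE; rewrite mul0rn mul1n.
Qed.

Lemma frac_mulr (A : zmodType) (a : A) k m :
  frac a k = frac (a *+ m.+1) (k.+1 * m.+1).-1.
Proof.
apply/frac_eq; exists 0%N; rewrite !muln1 prednK// -mulrnA.
by rewrite mulnC.
Qed.

Lemma fracD (A : zmodType) (a b : A) k l :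
  frac a k + frac b l = frac (a *+ l.+1 + b *+ k.+1) (k.+1 * l.+1).-1.
Proof. exact: ratz_addE. Qed.

Lemma rat_pullE n (P Q : gpair G) (f : pmap P Q) (a : coh E n Q) k :
  coh_pull (c := coh_rat E) f (frac a k) = frac (coh_pull f a) k.
Proof. exact: (ratz_mapE (pull f)). Qed.

Lemma rat_pullD n (P Q : gpair G) (f : pmap P Q) :
  {morph @coh_pull _ (coh_rat E) n P Q f : x y / x + y}.
Proof.
move=> x y; rewrite -(fracK x) -(fracK y) [in LHS]fracD !rat_pullE.
by rewrite fracD [coh_pull f _](raddfD (pull f)) !(raddfMn (pull f)).
Qed.

Lemma rat_pull0 n (P Q : gpair G) (f : pmap P Q) :
  coh_pull f (0 : coh (coh_rat E) n Q) = 0.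
Proof.
by apply: (addIr (coh_pull f (0 : coh (coh_rat E) n Q)));
  rewrite -rat_pullD !add0r.
Qed.

Lemma rat_pull_comp n (P Q T : gpair G) (g : pmap Q T) (f : pmap P Q)
    (x : coh (coh_rat E) n T) :
  coh_pull (pmap_comp g f) x = coh_pull f (coh_pull g x).
Proof. by rewrite -(fracK x) !rat_pullE (coh_pull_comp hE). Qed.

Lemma rat_pull_id n (P : gpair G) (x : coh (coh_rat E) n P) :
  coh_pull (pmap_id P) x = x.
Proof. by rewrite -(fracK x) rat_pullE (coh_pull_id hE). Qed.

(** Denominators are cleared: the numerator of [x] restricts to a torsion class, so a nonzero
    multiple of it restricts to zero and lifts integrally; the lift is then divided by that
    multiple. *)
Lemma rat_exact_tot n (P : gpair G) (x : coh (coh_rat E) n (pabs (ptot P))) :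
  coh_pull (pmap_incl P) x = 0 ->
  exists y : coh (coh_rat E) n P, coh_pull (pmap_rel P) y = x.
Proof.
rewrite -(fracK x) rat_pullE => /frac_eq0[m].
rewrite -[LHS](raddfMn (pull (pmap_incl P))) => /(coh_exact_tot hE)[y yE].
exists (frac y ((rden x).+1 * m.+1).-1).
by rewrite rat_pullE yE -frac_mulr.
Qed.

(** Pullback commutes with the integer multiples that witness equality of fractions, so integral
    injectivity cancels [f] from such a witness. *)
Lemma rat_pull_inj n (P Q : gpair G) (f : pmap P Q) :
  injective (@coh_pull _ E n P Q f) ->
  injective (@coh_pull _ (coh_rat E) n P Q f).
Proof.
move=> finj x y; rewrite -(fracK x) -(fracK y) !rat_pullE => /frac_eq[m].
rewrite -!(raddfMn (pull f)) => /finj mE.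
by apply/frac_eq; exists m.
Qed.

Lemma rat_cupE p q (P : gpair G) (a : coh E p (pabs (ptot P))) k
    (b : coh E q P) l :
  coh_cup (c := coh_rat E) (frac a k) (frac b l) =
  frac (coh_cup a b) (k.+1 * l.+1).-1.
Proof.
by apply: ratz_mulE; [exact: (coh_cupDl hE)|exact: (coh_cupDr hE)].
Qed.

Lemma rat_cup0l p q (P : gpair G) (y : coh (coh_rat E) q P) :
  coh_cup (0 : coh (coh_rat E) p (pabs (ptot P))) y = 0.
Proof.
rewrite -(fracK y) rat_cupE; apply/frac_eq0; exists 0%N; rewrite mulr1n.
by apply: (addIr (coh_cup 0 (rnum y))); rewrite -(coh_cupDl hE) !add0r.
Qed.

Lemma rat_cup_nat p q (P Q : gpair G) (f : pmap P Q)
    (x : coh (coh_rat E) p (pabs (ptot Q))) (y : coh (coh_rat E) q Q) :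
  coh_pull f (coh_cup x y) =
  coh_cup (coh_pull (pmap_abs f) x) (coh_pull f y).
Proof.
by rewrite -(fracK x) -(fracK y) rat_cupE !rat_pullE rat_cupE (coh_cup_nat hE).
Qed.

End RationalCohomology.

(** * General facts on continuity and quotient maps *)

Section Topology.
Variable R : realType.

Lemma continuous_pair (X Y Z : topologicalType) (f : X -> Y) (g : X -> Z) :
  continuous f -> continuous g -> continuous (fun x => (f x, g x)).
Proof. by move=> cf cg x; apply: cvg_pair; [exact: cf|exact: cg]. Qed.

Lemma real_complex_continuous : continuous (fun r : R => r%:C%C : cplx R).
Proof.
move=> r; apply/cvgrPdist_lt => e e0.
(* In the order on complex numbers a positive element is real, so the estimate takes place in
   [R]. *)
have eR : e = (complex.Re e)%:C%C by apply/esym/RRe_real/gtr0_real.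
have e0' : 0 < complex.Re e by move: e0; rewrite eR ltcR.
near=> s; rewrite -rmorphB /= normc_def/= expr0n/= addr0 sqrtr_sqr eR ltcR.
by near: s; exact: (@cvgr_dist_lt _ _ _ (nbhs r) _ id r).
Unshelve. all: by end_near. Qed.

Lemma within_open_continuous (X Y : topologicalType) (U : set X) (f : X -> Y) x :
  open U -> U x -> {within U, continuous f} -> {for x, continuous f}.
Proof.
by move=> oU Ux; rewrite continuous_open_subspace// => /(_ x); apply; exact/mem_set.
Qed.

(* [p * id] is again an open surjection, hence a quotient map. *)
Lemma open_quotient_prod (X Q T Z : topologicalType) (p : X -> Q)
    (f : Q * T -> Z) :
  (forall q, exists x, p x = q) -> (forall U, open U -> open (p @` U)) ->
  continuous (fun u : X * T => f (p u.1, u.2)) -> continuous f.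
Proof.
move=> ps po cf [q t] W /=; have [x <-] := ps q => nW.
have [[/= P N] [nP nN] PN] := cf (x, t) W nW.
exists (p @` P, N) => /=.
  split=> //; move: nP; rewrite nbhsE => -[U [oU Ux] UP].
  apply: (@filterS _ _ _ (p @` U)); first exact: image_subset.
  by apply: open_nbhs_nbhs; split; [exact: po|exists x].
move=> [_ s] [/= [y Py <-] Ns].
exact: (PN (y, s)).
Qed.

End Topology.

(** * Homotopy extension from an equivariant deformation of the cylinder *)

Section Cofibration.
Variables (R : realType) (G : topologicalGroupType).

(* [x |-> (W (x, t), s (x, t))] deforms the cylinder [X * [0, 1]] onto
   [X * 0 ∪ A * [0, 1]]. *)
Lemma gcofibration_retract (P : gpair G) (W : ptot P * R -> ptot P)
    (s : ptot P * R -> R) :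
  closed (psub P : set (ptot P)) -> continuous W -> continuous s ->
  (forall x t, 0 <= t <= 1 -> 0 <= s (x, t) <= 1) ->
  (forall x t, 0 <= t <= 1 -> 0 < s (x, t) -> gset_set (psub P) (W (x, t))) ->
  (forall x, W (x, 0) = x) -> (forall x, s (x, 0) = 0) ->
  (forall a t, gset_set (psub P) a -> 0 <= t <= 1 -> W (a, t) = a) ->
  (forall a t, gset_set (psub P) a -> 0 <= t <= 1 -> s (a, t) = t) ->
  (forall g x t, W (gact g x, t) = gact g (W (x, t))) ->
  (forall g x t, s (gact g x, t) = s (x, t)) ->
  gcofibration R P.
Proof.
move=> clA cW cs s01 sW W0 s0 WA sA Wg sg; split=> // Y f h [ch hg] h0.
(* Where [s = 0] and [W (x, t)] lies in [psub P] the two branches agree, because [h] starts at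
   [f]. *)
pose k x t := if insub (W (x, t)) is Some a then h a (s (x, t)) else f (W (x, t)).
have kin x t (a : gsub (psub P)) : val a = W (x, t) -> k x t = h a (s (x, t)).
  by move=> aW; rewrite /k -aW valK.
have kout x t : 0 <= t <= 1 -> s (x, t) = 0 -> k x t = f (W (x, t)).
  move=> t01 sxt; rewrite /k; case: insubP => [a _ aW|//].
  by rewrite sxt h0 /= -aW.
exists k; split; first split.
- pose I := [set p : ptot P * R | 0 <= p.2 <= 1].
  pose B := W @^-1` (psub P : set _).
  pose A := s @^-1` [set 0].
  have clI : closed I.
    rewrite (_ : I = snd @^-1` `[0 : R, 1]%classic); last first.
      by apply/seteqP; split=> p /=; rewrite in_itv.
    by apply: preimage_closed => //; [move=> p _; exact: cvg_snd|exact: itv_closed].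
  have clB : closed B by apply: preimage_closed.
  have clA' : closed A by apply: preimage_closed => //; exact: closed_eq.
  (* Continuity is pasted from two closed pieces of the strip: [s = 0], where [k] is [f \o W], and
     [W] in [psub P], where [k] is [h] at [(W, s)]. *)
  have -> : [set p : ptot P * R | 0 <= p.2 <= 1] = (A `&` I) `|` (B `&` I).
    apply/seteqP; split=> [[x t] /= t01|[x t] /= [[]|[]]//].
    have /andP[] := s01 x t t01; rewrite le_eqVlt => /predU1P[].
      by move=> sxt _; left; split.
    by move=> s_gt0 _; right; split=> //; exact: sW.
  apply: withinU_continuous; [exact: closedI|exact: closedI| |].
    apply: (@subspace_eq_continuous _ _ _ (f \o W)).
      by move=> [x t] /set_mem[/= sxt t01]; symmetry; exact: kout.
    apply: continuous_subspaceT => p; apply: continuous_comp; first exact: cW.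
    exact: gfun_continuous.
  (* [h] is continuous only on the strip over [psub P], so on this piece [k] is factored through
     that strip as a subtype. *)
  apply/subspace_sigL_continuousP.
  pose Z : topologicalType := set_type (B `&` I).
  have cv : continuous (set_val : Z -> _) by exact: initial_continuous.
  have ZBI (p : Z) : (B `&` I) (set_val p) := set_mem (valP p).
  have Bin (p : Z) : W (set_val p) \in (psub P : set _).
    by apply/mem_set; have [] := ZBI p.
  pose w (p : Z) : gsub (psub P) := exist _ (W (set_val p)) (Bin p).
  have cw : continuous w.
    apply: continuous_comp_initial => p.
    by apply: (@continuous_comp _ _ _ (set_val : Z -> _) W); [exact: cv|exact: cW].
  have csv : continuous (s \o (set_val : Z -> _)).
    by move=> p; apply: (@continuous_comp _ _ _ (set_val : Z -> _) s);
      [exact: cv|exact: cs].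
  pose J := [set p : gsub (psub P) * R | 0 <= p.2 <= 1].
  have strip (p : Z) : (w p, s (set_val p)) \in J.
    apply/mem_set; have [_] := ZBI p.
    by case: (set_val p) => x t /=; exact: s01.
  pose ws (p : Z) : set_type J := 
    exist (fun q => q \in J) (w p, s (set_val p)) (strip p).
  have cws : continuous ws.
    by apply: continuous_comp_initial; exact: continuous_pair.
  move/subspace_sigL_continuousP in ch.
  rewrite (_ : sigL _ _ = sigL _ (fun p => h p.1 p.2) \o ws); last first.
    apply/funext => p; have := kin (set_val p).1 (set_val p).2 (w p).
    by rewrite -surjective_pairing; exact.
  by move=> p; apply: continuous_comp; [exact: cws|exact: ch].
- move=> g x t t01; rewrite /k sg; case: insubP => [a _ aW|].
    (* Acting with the inverse of [g] shows that both sides of the equation take the same branch of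
       [k]. *)
    have Wx : W (x, t) \in (psub P : set _).
      have := valP a; rewrite aW Wg => /set_mem/(gset_inv g^-1%g).
      by rewrite -gactM mulVg gact1 => /mem_set.
    rewrite insubT -hg; last exact: s01.
    by congr h; apply: val_inj; rewrite /= aW Wg.
  move=> /negP gW; rewrite insubN ?Wg ?gfun_equivariant//.
  by apply/negP => /set_mem/(gset_inv g); rewrite -Wg => /mem_set.
- by move=> x; rewrite kout ?s0 ?W0// lexx ler01.
- move=> a t t01; have aA := set_mem (valP a).
  by rewrite (kin _ _ a) ?sA//= WA.
Qed.

End Cofibration.

(** * Norm and scalar multiplication on a complex bundle *)

Section BundleTopology.
Variables (R : realType) (G : topologicalGroupType) (B : gspace G).
Variable V : cbundle R B.

Definition vnorm (v : vtot V) : R := Num.sqrt (vnormsq v).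

Lemma Re_continuous : continuous (fun z : cplx R => complex.Re z).
Proof.
move=> z; apply/(@cvgrPdist_lt _ _ _ (nbhs z) (nbhs_filter z)) => e e0.
have e0' : 0 < e%:C%C :> cplx R by rewrite ltcR.
near=> w; have : `|z - w| < e%:C%C.
  by near: w; exact: (@cvgr_dist_lt (cplx R) _ _ (nbhs z) _ id z).
rewrite -ltcR; apply: le_lt_trans; rewrite -raddfB.
case: (z - w) => a b /=; rewrite normc_def /= lecR -sqrtr_sqr.
by apply: ler_wsqrtr; rewrite lerDl sqr_ge0.
Unshelve. all: by end_near. Qed.

(** The metric is continuous only on pairs in a common fiber, so the diagonal is taken into that
    subspace. *)
Lemma vnormsq_continuous : continuous (@vnormsq R G B V).
Proof.
move=> v; apply: (@continuous_comp _ (cplx R) _ (fun v => vherm v v)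
  (fun z => complex.Re z)); last exact: Re_continuous.
have := @vherm_continuous _ _ _ V; move/subspace_sigL_continuousP => ch.
pose D := [set p : vtot V * vtot V | vproj V p.1 = vproj V p.2].
pose d v : set_type D :=
  exist (fun p => p \in D) (v, v) (mem_set (erefl (vproj V v))).
have cd : continuous d.
  by apply: continuous_comp_initial; apply: continuous_pair => x; exact: cvg_id.
by apply: (@continuous_comp _ _ _ d (sigL D (fun p => vherm p.1 p.2)));
  [exact: cd|exact: ch].
Qed.

Lemma vnorm_continuous : continuous vnorm.
Proof.
move=> v; apply: (@continuous_comp _ _ _ (@vnormsq R G B V) Num.sqrt).
  exact: vnormsq_continuous.
exact: sqrt_continuous.
Qed.

(** In a local trivialization scaling becomes scaling of coordinates, which is jointly
    continuous. *)
Lemma vscale_continuous :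
  continuous (fun p : cplx R * vtot V => vscale p.1 p.2).
Proof.
move=> [c0 v0].
have [U [h [k [oU Uv0 ch ck [hp kh hk _ hZ]]]]] := vlocal V (vproj V v0).
have hE : \forall p \near (c0, v0),
    h (vproj V p.2, p.1 *: k p.2) = vscale p.1 p.2.
  have : open (vproj V @^-1` U).
    by apply: open_comp => // x _; exact: gfun_continuous.
  move=> oVU; exists (setT, vproj V @^-1` U) => /=.
    by split; [exact: (@filterT _ _ (nbhs_filter c0))|exact: open_nbhs_nbhs].
  by move=> [c v] [_ /= Uv]; rewrite hZ// hk.
have ch0 : {for (vproj V v0, c0 *: k v0), continuous h}.
  apply: within_open_continuous ch; last by [].
  rewrite (_ : U `*` setT = fst @^-1` U).
    by apply: open_comp => // x _; exact: cvg_fst.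
  by apply/seteqP; split=> x // [].
pose u (q : cplx R * vtot V) := (vproj V q.2, q.1 *: k q.2).
have cu : {for (c0, v0), continuous u}.
  apply: (@cvg_pair _ _ _ _ (nbhs (vproj V v0)) (nbhs (c0 *: k v0))).
    apply: (@cvg_comp _ _ _ snd (vproj V)); first exact: cvg_snd.
    exact: gfun_continuous.
  apply: (@cvg_comp _ _ _ (fun q : cplx R * vtot V => (q.1 : (cplx R)^o, k q.2))
    (fun q => q.1 *: q.2) _ (nbhs (c0 : (cplx R)^o, k v0)));
    last exact: (scale_continuous (c0 : (cplx R)^o, k v0)).
  apply: (@cvg_pair _ _ _ _ (nbhs (c0 : (cplx R)^o)) (nbhs (k v0)));
    first exact: cvg_fst.
  apply: (@cvg_comp _ _ _ snd k); first exact: cvg_snd.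
  apply: within_open_continuous ck => //.
  by apply: open_comp => // x _; exact: gfun_continuous.
apply: cvg_trans (near_eq_cvg hE) _ => /=; rewrite -(nbhs_singleton hE) /=.
exact: (@continuous_comp _ _ _ u h (c0, v0)).
Qed.

(** Unitality is read off in a local trivialization, where the fiber is a coordinate space. *)
Lemma vscale1 (v : vtot V) : vscale 1 v = v.
Proof.
have [U [h [k [_ Uv _ _ [_ _ hk _ hZ]]]]] := vlocal V (vproj V v).
by rewrite -{1}(hk v)// -hZ// scale1r hk.
Qed.

Lemma vnormsq_ge0 (v : vtot V) : 0 <= vnormsq v.
Proof. by have := vherm_ge0 v; rewrite lecE => /andP[]. Qed.

Lemma vnormsqZ (c : R) (v : vtot V) :
  vnormsq (vscale c%:C%C v) = c ^+ 2 * vnormsq v.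
Proof.
rewrite /vnormsq vhermZl ?vproj_scale// vhermC ?vproj_scale// vhermZl//.
by case: (vherm v v) => a b /=; rewrite !mul0r !subr0 mulrA expr2.
Qed.

Lemma sqr_vnorm (v : vtot V) : vnorm v ^+ 2 = vnormsq v.
Proof. by rewrite sqr_sqrtr// vnormsq_ge0. Qed.

Lemma vnorm_le1 (v : vtot V) : (vnorm v <= 1) = (vnormsq v <= 1).
Proof. by rewrite -sqr_vnorm expr_le1// sqrtr_ge0. Qed.

Lemma vnorm_eq1 (v : vtot V) : vnorm v = 1 <-> vnormsq v = 1.
Proof.
rewrite -sqr_vnorm; split=> [->|/eqP]; first by rewrite expr1n.
by rewrite sqrp_eq1 ?sqrtr_ge0// => /eqP.
Qed.

End BundleTopology.

(** * The sphere quotient is a cofibration in the disc quotient *)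

Section OrbibundleCofibration.
Variables (R : realType) (G : topologicalGroupType) (B : gspace G).
Variables (V : cbundle R B) (A : finGroupType) (act : bundle_action A V).

Let D := gsub (vdisc V).
Let p : gmap D (ptot (orb_pair act)) := gorb_proj (ba_disc_act act).

(** An invariant function is constant on orbits, so the representative chosen by [repr] does not
    matter. *)
Lemma orb_lift_repr (T : Type) (f : D -> T) (d : D) :
  (forall a d, f (ba_disc_act act a d) = f d) -> f (repr (p d)) = f d.
Proof.
move=> fA; have /gcls_eq/orb_relP[a] : gcls (orb_equiv (ba_disc_act act))
    (repr (p d)) = gcls _ d by rewrite /gcls reprK.
by move=> E; rewrite -[in RHS]E fA.
Qed.

(** Dividing by this number is the vector part of the projection of the cylinder from the zero
    vector at height 2. For [t] in [[0, 1]] the bound [2^-1] changes nothing; it keeps the divisor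
    positive, hence the quotient continuous, for all real [t]. *)
Definition radius (v : vtot V) (t : R) : R :=
  Num.max (vnorm v) (Num.max (2^-1) (1 - t / 2)).

Lemma radius_gt0 v t : 0 < radius v t.
Proof. by rewrite !lt_max invr_gt0 ltr0n orbT. Qed.

Lemma vnormsq_radial v t :
  vnormsq (vscale ((radius v t)^-1)%:C%C v) = (vnorm v / radius v t) ^+ 2.
Proof. by rewrite vnormsqZ -sqr_vnorm exprMn mulrC. Qed.

Lemma radial_disc (d : D) t :
  vscale ((radius (val d) t)^-1)%:C%C (val d) \in (vdisc V : set _).
Proof.
apply/mem_set; rewrite /= vnormsq_radial expr_le1//; last first.
  by rewrite divr_ge0 ?sqrtr_ge0// ltW// radius_gt0.
by rewrite ler_pdivrMr ?radius_gt0// mul1r le_max lexx.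
Qed.

Definition radial (d : D) (t : R) : D :=
  exist _ (vscale ((radius (val d) t)^-1)%:C%C (val d)) (radial_disc d t).

Lemma disc_vnorm_le1 (d : D) : vnorm (val d) <= 1.
Proof. by rewrite vnorm_le1; exact: set_mem (valP d). Qed.

Lemma vnorm_ba a (d : D) : vnorm (val (ba_disc_act act a d)) = vnorm (val d).
Proof. by rewrite /vnorm /= ba_normsq. Qed.

Lemma radial_ba a d t :
  radial (ba_disc_act act a d) t = ba_disc_act act a (radial d t).
Proof. by apply: val_inj; rewrite /= ba_scale /radius /vnorm ba_normsq. Qed.

Lemma radial_gact g d t : radial (gact g d) t = gact g (radial d t).
Proof. by apply: val_inj; rewrite /= vscale_act /radius /vnorm vnormsq_act. Qed.

Lemma radius1 v t : 0 <= t -> vnorm v = 1 -> radius v t = 1.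
Proof.
move=> t0 v1; rewrite /radius v1 max_l// ge_max invf_le1 ?ltr0n// ler1n/=.
by rewrite lerBlDr lerDl divr_ge0.
Qed.

Lemma radial_sphere d t : 0 <= t -> vnorm (val d) = 1 -> radial d t = d.
Proof.
by move=> t0 d1; apply: val_inj; rewrite /= radius1// invr1 vscale1.
Qed.

Lemma radial0 d : radial d 0 = d.
Proof.
apply: val_inj; rewrite /= /radius mul0r subr0 [Num.max 2^-1 1]max_r; last first.
  by rewrite invf_le1 ?ltr0n// ler1n.
by rewrite max_r ?disc_vnorm_le1// invr1 vscale1.
Qed.

(** The norm is invariant under [A], so whether an orbit meets the sphere can be tested at any of
    its points. *)
Lemma psub_orb_pair (d : D) :
  gset_set (psub (orb_pair act)) (p d) <-> vnorm (val d) = 1.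
Proof.
split=> [[d' d'1 dd']|/vnorm_eq1 d1]; last by exists d.
rewrite -(orb_lift_repr (f := fun d => vnorm (val d)) d vnorm_ba) -dd'.
rewrite (orb_lift_repr (f := fun d => vnorm (val d)) d' vnorm_ba).
exact/vnorm_eq1.
Qed.

Lemma radius_continuous :
  continuous (fun u : D * R => radius (val u.1) u.2).
Proof.
have cn : continuous (fun u : D * R => vnorm (val u.1)).
  move=> u; apply: (@continuous_comp _ _ _ (fun u : D * R => set_val u.1)).
    apply: (@continuous_comp _ _ _ fst); first exact: cvg_fst.
    exact: gsub_val_cont.
  exact: vnorm_continuous.
apply: (max_fun_continuous cn).
apply: (@max_fun_continuous _ _ R (fun=> 2^-1) (fun u : D * R => 1 - u.2 / 2)).
  by move=> u; exact: cvg_cst.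
move=> u; apply: cvgB; first exact: cvg_cst.
by apply: cvgM; [exact: cvg_snd|exact: cvg_cst].
Qed.

Lemma radial_continuous : continuous (fun u : D * R => radial u.1 u.2).
Proof.
apply: continuous_comp_initial.
pose q (u : D * R) : cplx R * vtot V :=
  (((radius (val u.1) u.2)^-1)%:C%C, set_val u.1).
have cq : continuous q.
  apply: continuous_pair => u.
    apply: (@continuous_comp _ _ _ (fun u : D * R => (radius (val u.1) u.2)^-1)
      (fun r => r%:C%C : cplx R)); last exact: real_complex_continuous.
    by apply: cvgV; [rewrite gt_eqF// radius_gt0|exact: radius_continuous].
  apply: (@continuous_comp _ _ _ fst); first exact: cvg_fst.
  exact: gsub_val_cont.
move=> u.
exact: (@continuous_comp _ _ _ q _ u (cq u) (@vscale_continuous _ _ _ V _)).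
Qed.

(** Radial rescaling commutes with [A] and the norm is invariant, so the deformation of the disc
    bundle descends to the quotient. *)
Lemma orb_pair_gcofibration : gcofibration R (orb_pair act).
Proof.
pose nq (q : ptot (orb_pair act)) := vnorm (val (repr q : D)).
have nqE d : nq (p d) = vnorm (val d).
  exact: (orb_lift_repr (f := fun d => vnorm (val d)) d vnorm_ba).
pose W (u : ptot (orb_pair act) * R) := p (radial (repr u.1) u.2).
have WE d t : W (p d, t) = p (radial d t).
  apply: (orb_lift_repr (f := fun d => p (radial d t))) => a d'.
  by rewrite radial_ba; symmetry; apply/gcls_eq/orb_relP; exists a.
(* This height is positive exactly when the norm exceeds [1 - t / 2], and for [t >= 0] it equals [t]
   on unit vectors. *)
pose s (u : ptot (orb_pair act) * R) := Num.max 0 (2 * nq u.1 - 2 + u.2).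
have ps := @gcls_surj _ _ (orb_equiv (ba_disc_act act)).
have po := @gcls_open _ _ (orb_equiv (ba_disc_act act)) (orb_open _).
have cn : continuous nq.
  apply: (repr_comp_continuous (g := fun d : D => vnorm (val d)))
    => [d|d d' /eqP dd'].
    by apply: (@continuous_comp _ _ _ set_val (@vnorm _ _ _ V));
      [exact: gsub_val_cont|exact: vnorm_continuous].
  by apply/eqP; rewrite -!nqE; congr nq.
apply: (gcofibration_retract (W := W) (s := s)).
- rewrite (_ : gset_set _ = nq @^-1` [set 1]).
    by apply: preimage_closed => //; exact: closed_eq.
  by apply/seteqP; split=> q; have [d <-] := ps q;
    rewrite /preimage /= nqE => /psub_orb_pair.
(* Continuity is checked before passing to orbits, since the orbit map is open. *)
- apply: (open_quotient_prod ps po).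
  rewrite (_ : (fun _ => _) = fun u => p (radial u.1 u.2)); last first.
    by apply/funext => u; rewrite WE.
  move=> u; apply: continuous_comp; first exact: radial_continuous.
  exact: gfun_continuous.
- apply: (@max_fun_continuous _ _ R (fun=> 0)
    (fun u : ptot (orb_pair act) * R => 2 * nq u.1 - 2 + u.2)).
    by move=> u; exact: cvg_cst.
  move=> u; apply: cvgD; last exact: cvg_snd.
  apply: cvgB; last exact: cvg_cst.
  apply: cvgM; first exact: cvg_cst.
  apply: (@continuous_comp _ _ _ fst); first exact: cvg_fst.
  exact: cn.
- move=> q t /andP[t0 t1]; have [d <-] := ps q; have := disc_vnorm_le1 d.
  by rewrite /s nqE le_max lexx/= ge_max ler01/= => d1; lra.
- move=> q t /andP[t0 t1]; have [d <-] := ps q.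
  rewrite /s nqE lt_max ltxx/= => d1; rewrite WE; apply/psub_orb_pair.
  apply/vnorm_eq1; rewrite /= vnormsq_radial.
  (* Positive height puts the norm above [1 - t / 2], itself at least [2^-1], so the norm is the
     maximum and the rescaled vector has norm 1. *)
  suff -> : radius (val d) t = vnorm (val d).
    by rewrite divff ?expr1n// gt_eqF//; lra.
  by apply/max_idPl; rewrite ge_max; apply/andP; split; lra.
- by move=> q; have [d <-] := ps q; rewrite WE radial0.
- move=> q; have [d <-] := ps q; have := disc_vnorm_le1 d.
  by rewrite /s nqE => d1; apply/max_idPl => /=; lra.
- move=> q t; have [d <-] := ps q => /psub_orb_pair d1 /andP[t0 t1].
  by rewrite WE radial_sphere.
- move=> q t; have [d <-] := ps q => /psub_orb_pair d1 /andP[t0 t1].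
  by rewrite /s nqE d1 mulr1 subrr add0r max_r.
- move=> g q t; have [d <-] := ps q.
  by rewrite -[gact g _](gfun_equivariant p) !WE radial_gact gfun_equivariant.
- move=> g q t; have [d <-] := ps q.
  by rewrite /s -[gact g _](gfun_equivariant p) !nqE /vnorm /= vnormsq_act.
Qed.

End OrbibundleCofibration.

(** * Thom isomorphism, excision and a single attaching step *)

Section Injectivity.
Variables (R : realType) (G : topologicalGroupType) (E : cohData G).
Hypothesis hE : cohAxioms R E.
Let EQ := coh_rat E.

Lemma eq_pmap (P Q : gpair G) (f g : pmap P Q) : f =1 g -> f = g.
Proof.
case: f g => [[f fc fe] fs] [[g gc ge] gs] /= /funext fg; subst g.
have ? := Prop_irrelevance gc fc; have ? := Prop_irrelevance ge fe.
by subst gc ge; rewrite (Prop_irrelevance gs fs).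
Qed.

(** Commuting triangles can thus be checked on points, the proof components of maps being
    irrelevant. *)
Lemma pull_comp_eq n (P Q T : gpair G) (g : pmap Q T) (f : pmap P Q)
    (h : pmap P T) (x : coh EQ n T) :
  (forall u, g (f u) = h u) -> coh_pull f (coh_pull g x) = coh_pull h x.
Proof.
move=> gfh; rewrite -(rat_pull_comp hE).
by have -> : pmap_comp g f = h by exact: eq_pmap.
Qed.

Lemma so_proj_zero (B : gspace G) (xi : simple_orbibundle R EQ B) b :
  so_proj xi (so_zero xi b) = b.
Proof.
rewrite -[RHS](vproj_zero (so_bundle xi)).
exact: (orb_lift_repr (act := so_act xi)
  (f := fun d => vproj (so_bundle xi) (val d)) _ (orb_pair_projE (so_act xi))).
Qed.

(** By the Thom isomorphism [y] is the pullback of some [b] cupped with [eta]; along the zero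
    section it restricts to [b] times the Euler class, which forces [b = 0]. *)
Lemma thom_euler_inj (B : gspace G) (xi : simple_orbibundle R EQ B)
    (eta : coh EQ (so_rank xi) (so_pair xi)) n (y : coh EQ n (so_pair xi)) :
  thom_class (so_proj xi) eta -> ~ zero_divisor (euler_class eta) ->
  coh_pull (pmap_abs (so_zero xi)) (coh_pull (pmap_rel (so_pair xi)) y) = 0 ->
  y = 0.
Proof.
(* Degrees range over all integers, so every [n], even below the rank, is the shift of a degree on
   the base. *)
have [m mE] : exists m, n = m + so_rank xi.
  by exists (n - so_rank xi); rewrite subrK.
subst n => /(_ m) [thi thK thK'] nzd; rewrite -(thK' y).
move: (thi y) => b; rewrite !(rat_cup_nat hE) -(rat_pull_comp hE).
rewrite (@pull_comp_eq _ _ _ _ _ _ (pmap_id (pabs B))); last first.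
  exact: so_proj_zero.
rewrite (rat_pull_id hE) => be0; have [->|b0] := pselect (b = 0).
  by rewrite (rat_pull0 hE) (rat_cup0l hE).
by case: nzd; exists m, b; split=> //; right.
Qed.

(** Exactness lifts [x] to a class of the pair [(T, S)], and excision carries the lift to the disc
    and sphere quotients, where [thom_euler_inj] shows that it vanishes. *)
Lemma stratum_step (X : gspace G) (S T : gset X) (B : gspace G)
    (xi : simple_orbibundle R EQ B) (eta : coh EQ (so_rank xi) (so_pair xi))
    (ch : gmap (ptot (so_pair xi)) (gsub T)) (ST : S `<=` T)
    n (x : coh EQ n (pabs (gsub T))) :
  thom_class (so_proj xi) eta -> ~ zero_divisor (euler_class eta) ->
  attached (set_val @^-1` S : set (gsub T))
    (fun _ : unit => psub (so_pair xi) : set (ptot _)) (fun _ : unit => ch) ->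
  coh_pull (pmap_abs (grestr (f := gmap_id X) ST)) x = 0 ->
  coh_pull (pmap_abs (gmap_comp ch (so_zero xi))) x = 0 -> x = 0.
Proof.
move=> th nzd att xS xB.
pose Q := GPair (gset_pre (gincl T) S).
have chS : psub (so_pair xi) `<=` ch @^-1` psub Q.
  by have [/(_ tt) chS _ _ _] := att; rewrite -chS.
pose f : pmap (so_pair xi) Q := PMap chS.
have QS : psub Q `<=` gincl T @^-1` S by [].
have [] := rat_exact_tot hE (P := Q) (x := x).
  rewrite -(@pull_comp_eq _ _ _ _ (pmap_abs (grestr (f := gmap_id X) ST))
    (pmap_abs (grestr QS))) ?xS ?(rat_pull0 hE)//.
  by move=> u; apply: val_inj.
move=> y yx; suff y0 : y = 0 by rewrite -yx y0 (rat_pull0 hE).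
have cof := orb_pair_gcofibration (so_act xi).
(* Excision is an integral statement; its injectivity half is what passes to rational coefficients
   here. *)
have finj := rat_pull_inj hE (bij_inj (@coh_excision _ _ _ hE n _ _ f cof att)).
apply: finj; rewrite (rat_pull0 hE); apply: thom_euler_inj th nzd _.
(* The excised lift and [x] restrict to the same class on the zero section: both routes are [ch]
   after [so_zero xi]. *)
rewrite -(rat_pull_comp hE) -(rat_pull_comp hE) -xB -yx.
by apply/esym/pull_comp_eq.
Qed.

End Injectivity.

(** * Induction along the stratification *)

Section Filtration.
Variables (R : realType) (G : topologicalGroupType) (E : cohData G).
Hypothesis hE : cohAxioms R E.
Variable eta : forall (B : gspace G) (xi : simple_orbibundle R (coh_rat E) B),
  coh (coh_rat E) (so_rank xi) (so_pair xi).
Hypothesis heta : orbi_thom_classes eta.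
Variables (X : gspace G) (S : orbi_stratified R (coh_rat E) X).
Hypothesis heuler : forall j : 'I_(os_len S),
  ~ zero_divisor (euler_class (eta (os_bundle j))).

(** Quantifying over all maps with prescribed underlying points keeps the hypotheses stable under
    passage to smaller strata, and constrains only those bases whose inclusion factors through
    stratum [k]. *)
Lemma stratum_kernel k n (x : coh (coh_rat E) n (pabs (gsub (os_strat S k)))) :
  (k <= os_len S)%N ->
  (forall f : pmap (pabs (gsub (os_strat S 0))) (pabs (gsub (os_strat S k))),
    (forall u, val (f u) = val u) -> coh_pull f x = 0) ->
  (forall (j : 'I_(os_len S))
      (f : pmap (pabs (os_base j)) (pabs (gsub (os_strat S k)))),
    (forall u, val (f u) = os_incl j u) -> coh_pull f x = 0) ->
  x = 0.
Proof.
elim: k x => [|k IH] x kl x0 xB.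
  (* On the bottom stratum the identity is one of the maps allowed in the first hypothesis. *)
  by rewrite -(rat_pull_id hE x); apply: x0.
pose j := Ordinal kl.
apply: (@stratum_step _ _ _ hE X (os_strat S k) (os_strat S k.+1) _
  (os_bundle j) (eta (os_bundle j)) (os_char j) (@os_mono _ _ _ _ S k) n x
  (heta _ (os_base_gcw j)) (@heuler j) (os_attached j)).
  (* A map into stratum [k], followed by the inclusion into the next one, has the same points in
     [X], so both hypotheses are inherited. *)
  apply: IH => [|f fv|i f fi]; first exact: ltnW.
    rewrite -(rat_pull_comp hE); apply: x0 => u; exact: fv.
  rewrite -(rat_pull_comp hE); apply: (xB i) => u; exact: fi.
exact: (xB j).
Qed.

End Filtration.

Theorem proposition2p2 (R : realType) (G : topologicalGroupType)
    (E : cohData G) (hE : cohAxioms R E)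
    (hrep : coh_represented R E) (hor : complex_oriented R E)
    (eta : forall (B : gspace G) (xi : simple_orbibundle R (coh_rat E) B),
        coh (coh_rat E) (so_rank xi) (so_pair xi))
    (heta : orbi_thom_classes eta)
    (X : gspace G) (hX : is_finite_gcw R X)
    (S : orbi_stratified R (coh_rat E) X)
    (heuler : forall j : 'I_(os_len S),
        ~ zero_divisor (euler_class (eta _ (os_bundle j)))) :
  forall n : int, injective (@os_restrict R G (coh_rat E) X S n).
Proof.
move=> n x y xy; have xy0 := congr1 fst xy; have xyB := congr1 snd xy.
apply/eqP; rewrite -subr_eq0; apply/eqP.
have d0 : coh_pull (pmap_abs (gincl (os_strat S 0))) (x - y) = 0.
  by apply: (addIr (coh_pull (pmap_abs (gincl (os_strat S 0))) y));
    rewrite -(rat_pullD hE) subrK add0r.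
have dB (j : 'I_(os_len S)) : coh_pull (pmap_abs (os_incl j)) (x - y) = 0.
  apply: (addIr (coh_pull (pmap_abs (os_incl j)) y)).
  by rewrite -(rat_pullD hE) subrK add0r; have := congr1 (fun F => F j) xyB; exact.
move: (x - y) d0 dB => {xy xy0 xyB x y} x x0 xB.
(* The last stratum is all of [X], but as a subtype it is a different space; an explicit inverse [r]
   of its inclusion recovers [x] from its restriction. *)
have XT : [set: X] `<=` gmap_id X @^-1` os_strat S (os_len S).
  by rewrite os_top.
pose XS := gsub (os_strat S (os_len S)).
pose rf (u : X) : XS :=
  exist (fun u => u \in (os_strat S (os_len S) : set X)) u (mem_set (XT u I)).
have rc : continuous rf.
  by apply: continuous_comp_initial => u; exact: cvg_id.
have re g u : rf (gact g u) = gact g (rf u) by apply: val_inj.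
pose r : gmap X XS := GMap rc re.
rewrite -(rat_pull_id hE x).
rewrite -(@pull_comp_eq _ _ _ hE _ _ _ _ (pmap_abs (gincl _)) (pmap_abs r))//.
suff -> : coh_pull (pmap_abs (gincl (os_strat S (os_len S)))) x = 0.
  exact: (rat_pull0 hE).
apply: (stratum_kernel hE heta heuler (leqnn _)) => [f fv|j f fv].
  by rewrite -x0; apply: (pull_comp_eq hE).
by rewrite -(xB j); apply: (pull_comp_eq hE).
Qed.
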